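(* Let $(\mathbf{v}_i)_{i\ge1}$ be $[0,1]$-valued random variables that are conditionally i.i.d. given $\boldsymbol{\nu}$ with law $\boldsymbol{\nu}$, where $\boldsymbol{\nu}$ is a species sampling process on $[0,1]$ with base measure $\nu_0$, EPPF $\pi_\nu$ and tie probability $\rho_\nu$. Let $\mathbf{w}_1=\mathbf{v}_1$, $\mathbf{w}_j=\mathbf{v}_j\prod_{i<j}(1-\mathbf{v}_i)$. Let $c(v)=1\wedge v(1-v)^{-1}$ for $v\in[0,1]$ (with $c(1)=1$) and $\overrightarrow{\nu_0}(x)=\nu_0([0,x])$. Then for every $j\ge1$: (a) $\mathbb{P}[\mathbf{w}_j\ge\mathbf{w}_{j+1}]=\rho_\nu+(1-\rho_\nu)\,\mathbb{E}[\overrightarrow{\nu_0}(c(\mathbf{v}))]$, where $\mathbf{v}\sim\nu_0$. (b) Almost surely, $$\mathbb{P}[\mathbf{w}_j\ge\mathbf{w}_{j+1}\mid\mathbf{w}_1,\dots,\mathbf{w}_j]=\mathbb{P}[\mathbf{v}_{j+1}\le c(\mathbf{v}_j)\mid\mathbf{v}_1,\dots,\mathbf{v}_j]=\sum_{i=1}^{\mathbf{K}_j}\frac{\pi_\nu(\mathbf{n}^{(i)})}{\pi_\nu(\mathbf{n})}\mathbf{1}_{\{\mathbf{v}^*_i\le c(\mathbf{v}_j)\}}+\frac{\pi_\nu(\mathbf{n}^{(\mathbf{K}_j+1)})}{\pi_\nu(\mathbf{n})}\overrightarrow{\nu_0}(c(\mathbf{v}_j)),$$ where $\mathbf{v}^*_1,\dots,\mathbf{v}^*_{\mathbf{K}_j}$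 are the distinct values among $\mathbf{v}_1,\dots,\mathbf{v}_j$, $\mathbf{n}=(\mathbf{n}_1,\dots,\mathbf{n}_{\mathbf{K}_j})$ with $\mathbf{n}_i=|\{l\le j:\mathbf{v}_l=\mathbf{v}^*_i\}|$, $\mathbf{n}^{(i)}$ is $\mathbf{n}$ with its $i$-th entry increased by one, and $\mathbf{n}^{(\mathbf{K}_j+1)}=(\mathbf{n}_1,\dots,\mathbf{n}_{\mathbf{K}_j},1)$.
   Context: A species sampling process on $[0,1]$ with base measure $\nu_0$ (a diffuse probability measure) is a random probability measure $\boldsymbol{\nu}=\sum_{j\ge1}\mathbf{p}_j\delta_{\boldsymbol{\eta}_j}+(1-\sum_j\mathbf{p}_j)\nu_0$ with $\mathbf{p}_j\ge0$, $\sum_j\mathbf{p}_j\le1$ a.s., independent of i.i.d. atoms $\boldsymbol{\eta}_j\sim\nu_0$. For a sequence $(\mathbf{v}_i)$ conditionally i.i.d. from $\boldsymbol{\nu}$, let $\boldsymbol{\Pi}(\mathbf{v}_{1:n})$ be the random partition of $\{1,\dots,n\}$ with $i,l$ in the same block iff $\mathbf{v}_i=\mathbf{v}_l$; the EPPF is the symmetric function $\pi_\nu$ with $\mathbb{P}[\boldsymbol{\Pi}(\mathbf{v}_{1:n})=\{A_1,\dots,A_k\}]=\pi_\nu(|A_1|,\dots,|A_k|)$ for every partition. The tie probability is $\rho_\nu=\pi_\nu(2)=\mathbb{P}[\mathbf{v}_1=\mathbf{v}_2]$. *)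

(* Defs.v *)
From HB Require Import structures.
From mathcomp Require Import all_boot all_order all_algebra.
From mathcomp Require Import all_classical all_reals all_analysis.
From mathcomp Require Import measurable_realfun.
Set Implicit Arguments. Unset Strict Implicit. Unset Printing Implicit Defensive.
Import Order.TTheory GRing.Theory Num.Theory.
Import numFieldNormedType.Exports.
Local Open Scope classical_set_scope.
Local Open Scope ring_scope.

Section Defs.
Context {d : measure_display} {T : measurableType d} {R : realType}.

Definition sigma_rv (X : nat -> T -> R) (I : set nat) : set (set T) :=
  <<s [set S | exists i (D : set R), I i /\ measurable D /\ S = X i @^-1` D] >>.

Definition ssp_nu (nu0 : set R -> \bar R) (p eta : nat -> T -> R)
    (w : T) (C : set R) : \bar R :=
  (\sum_(0 <= k <oo) ((p k w)%:E * (\1_C (eta k w))%:E) +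
   (1 - \sum_(0 <= k <oo) (p k w)%:E) * nu0 C)%E.

Definition sigma_rm (nu : T -> set R -> \bar R) : set (set T) :=
  <<s [set S | exists (C : set R) (D : set (\bar R)),
          measurable C /\ measurable D /\ S = (fun w => nu w C) @^-1` D] >>.

Definition cond_prob_is (P : probability T R) (G : set (set T)) (A : set T)
    (Z : T -> R) : Prop :=
  measurable_fun setT Z /\
  (exists Y : T -> R,
      (forall D : set R, measurable D -> G (Y @^-1` D)) /\
      {ae P, forall w, Y w = Z w}) /\
  (forall B, G B -> P (A `&` B) = (\int[P]_(w in B) (Z w)%:E)%E).

(** the random partition of {1,...,n} induced by v_1,...,v_n equals Pt
    (element i : 'I_n stands for index i+1) *)
Definition partition_event (v : nat -> T -> R) (n : nat)
    (Pt : {set {set 'I_n}}) : set T :=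
  [set w | forall i l : 'I_n, v i.+1 w = v l.+1 w <-> [exists A in Pt, (i \in A) && (l \in A)]].

End Defs.

Definition cfun {R : realType} (x : R) : R :=
  if x == 1 then 1 else Num.min 1 (x / (1 - x)).

Definition cdf_of {R : realType} (nu0 : set R -> \bar R) (x : R) : R :=
  fine (nu0 `[0, x]%classic).

(** stick-breaking weights w_j = v_j prod_{i<j} (1 - v_i), indices j >= 1 *)
Definition stick {T : Type} {R : realType} (v : nat -> T -> R) (j : nat)
    (w : T) : R :=
  v j w * \prod_(1 <= i < j) (1 - v i w).

(** the right-hand side of (b): predictive probability of [0, c(v_j)] *)
Definition pred_rhs {T : Type} {R : realType} (pi : seq nat -> R)
    (nu0 : set R -> \bar R) (v : nat -> T -> R) (j : nat) (w : T) : R :=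
  let obs := [seq v i w | i <- iota 1 j] in
  let vs := undup obs in
  let K := size vs in
  let n := [seq count_mem x obs | x <- vs] in
  let cj := cfun (v j w) in
  \sum_(i < K) pi (incr_nth n i) / pi n * (nth 0 vs i <= cj)%R%:R
  + pi (rcons n 1%N) / pi n * cdf_of nu0 cj.

(* Main.v *)
(* Multiplying out the product of the nu(A_i) and using that the weights are
   independent of the i.i.d. atoms shows that the law of (v_1, ..., v_n) is a
   finite mixture, over the patterns s of ties, of the laws of
   (eta_(s 1), ..., eta_(s n)).  As nu0 is diffuse, the atoms are almost surely
   distinct, so the weight of s is the probability that the v_i have pattern s,
   which is the EPPF evaluated at the block sizes of s.  Thus, given the pattern,
   the distinct values are i.i.d. with law nu0, and comparing the mixtures for j
   and j+1 observations gives the prediction rule.  Part (a) is the case of two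
   observations, the pair (v_j, v_{j+1}) being distributed as (v_1, v_2).
   Finally no v_i equals 1 almost surely, hence the weights w_1, ..., w_j and the
   variables v_1, ..., v_j determine each other, and w_j >= w_{j+1} is equivalent
   to v_{j+1} <= c(v_j). *)
Require Import Defs.
From HB Require Import structures.
From mathcomp Require Import all_boot all_order all_algebra.
From mathcomp Require Import all_classical all_reals all_analysis.
From mathcomp Require Import measurable_realfun.
Set Implicit Arguments. Unset Strict Implicit. Unset Printing Implicit Defensive.
Import Order.TTheory GRing.Theory Num.Theory.
Import numFieldNormedType.Exports.
Local Open Scope classical_set_scope.
Local Open Scope ring_scope.

(** * Patterns of ties *)

(** The law of the observations is prescribed on rectangles only, by mixed moments of [ssp_nu]; laws
    are therefore compared there and extended to all events about finitely many coordinates by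
    uniqueness of measures. The obstacle is that such a moment is a product of infinite series with
    diffuse remainders. The coefficients that come out of expanding it are never computed: it
    suffices that they exist and do not depend on the rectangle, since the disjointness of the
    pattern events identifies them afterwards. A pattern is encoded as a list of labels that double
    as indices of atoms. One more observation then appends one label, either an old one or the
    length of the list, and these two cases become the two kinds of term in the prediction rule. *)

Section patterns.
Context {E : eqType}.
Implicit Types (x : nat -> E).

(** [index] defaults to the length [i] when the value is new, so a first occurrence is labelled by
    its own position. *)
Definition lab x (i : nat) : nat := index (x i) (mkseq x i).

Definition pat (n : nat) x : seq nat := mkseq (lab x) n.

Lemma lab_le x i : (lab x i <= i)%N.
Proof. by rewrite /lab -[leqRHS](size_mkseq x) index_size. Qed.

Lemma lab_eq x i : x (lab x i) = x i.
Proof.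
have [lt_i|] := ltnP (lab x i) i; last first.
  by move=> le_i; congr x; apply/eqP; rewrite eqn_leq lab_le.
rewrite -(nth_mkseq (x i) x lt_i) nth_index// -index_mem size_mkseq//.
Qed.

Lemma labE x i k : (lab x i == lab x k) = (x i == x k).
Proof.
apply/idP/idP => [/eqP labik|/eqP]; first by rewrite -(lab_eq x i) labik lab_eq.
wlog ik : i k / (i <= k)%N => [h|xik].
  by have [/h//|/ltnW/h h' /esym/h'] := leqP i k; rewrite eq_sym.
rewrite eq_sym /lab /mkseq -(subnKC ik) iotaD map_cat index_cat subnKC//.
rewrite -xik add0n; case: ifPn => // xi; rewrite (memNindex xi) size_map.
move: ik; rewrite leq_eqVlt => /predU1P[<-|ik].
  by rewrite subnn/= addn0.
by rewrite -(subnSK ik) /= eqxx addn0.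
Qed.

End patterns.

Lemma lab_ker (E E' : eqType) (x : nat -> E) (y : nat -> E') n :
  (forall i k, (i < n)%N -> (k < n)%N -> (x i == x k) = (y i == y k)) ->
  forall i, (i < n)%N -> lab x i = lab y i.
Proof.
move=> xy i ni; rewrite /lab /mkseq /index !find_map.
apply: eq_in_find => k; rewrite mem_iota/= => ki.
by rewrite xy// (ltn_trans ki).
Qed.

Lemma pat_ker (E E' : eqType) (x : nat -> E) (y : nat -> E') n :
  (forall i k, (i < n)%N -> (k < n)%N -> (x i == x k) = (y i == y k)) ->
  pat n x = pat n y.
Proof.
move=> xy; apply/eq_in_map => i; rewrite mem_iota => ni.
exact: lab_ker xy _ _.
Qed.

(** The two value types may differ: this lets observations, labellings of atoms and lists of labels
    be compared through their ties alone. *)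
Lemma eq_pat (E E' : eqType) (x : nat -> E) (y : nat -> E') n :
  pat n x = pat n y <->
  (forall i k, (i < n)%N -> (k < n)%N -> (x i == x k) = (y i == y k)).
Proof.
split=> [xy i k ni nk|]; last exact: pat_ker.
have lxy l : (l < n)%N -> lab x l = lab y l.
  by move=> ln; rewrite -(nth_mkseq 0%N (lab x) ln) -/(pat _ _) xy nth_mkseq.
by rewrite -labE -[RHS]labE !lxy.
Qed.

Lemma size_pat (E : eqType) (x : nat -> E) n : size (pat n x) = n.
Proof. exact: size_mkseq. Qed.

Lemma nth_pat (E : eqType) (x : nat -> E) n i :
  (i < n)%N -> nth 0%N (pat n x) i = lab x i.
Proof. exact: nth_mkseq. Qed.

(* [canon] singles out the patterns that do occur; such an [s] maps [i] to the
   least index of the block of [i]. *)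
Definition canon (s : seq nat) : bool := pat (size s) (nth 0%N s) == s.

Lemma pat_canon (E : eqType) (x : nat -> E) n : canon (pat n x).
Proof.
rewrite /canon size_pat; apply/eqP/pat_ker => i k ni nk.
by rewrite !nth_pat// labE.
Qed.

Lemma patS (E : eqType) (x : nat -> E) n : pat n.+1 x = rcons (pat n x) (lab x n).
Proof. exact: mkseqS. Qed.

Lemma eq_in_pat (E : eqType) (x y : nat -> E) n :
  (forall i, (i < n)%N -> x i = y i) -> pat n x = pat n y.
Proof. by move=> xy; apply: pat_ker => i k ni nk; rewrite !xy. Qed.

(* A superset of the canonical patterns of length [n], convenient for sums. *)
Fixpoint pats (n : nat) : seq (seq nat) :=
  if n is n'.+1 then [seq rcons s k | s <- pats n', k <- iota 0 n'.+1]
  else [:: [::]].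

Lemma mem_patsS n s :
  reflect (exists t k, [/\ t \in pats n, (k <= n)%N & s = rcons t k])
          (s \in pats n.+1).
Proof.
have -> : pats n.+1 = [seq rcons t k | t <- pats n, k <- iota 0 n.+1] by [].
apply: (iffP allpairsPdep) => -[t [k [tn kn ->]]]; exists t, k.
  by move: kn; rewrite mem_iota.
by rewrite mem_iota.
Qed.

Lemma mem_pat (E : eqType) (x : nat -> E) n : pat n x \in pats n.
Proof.
elim: n => [|n ih]//; rewrite patS; apply/mem_patsS.
by exists (pat n x), (lab x n); rewrite ih lab_le.
Qed.

Lemma size_pats n s : s \in pats n -> size s = n.
Proof.
elim: n s => [|n ih] s; first by rewrite inE => /eqP->.
by move=> /mem_patsS[t [k [/ih <- _ ->]]]; rewrite size_rcons.
Qed.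

Lemma pats_lt n s i : s \in pats n -> i \in s -> (i < n)%N.
Proof.
elim: n s => [|n ih] s; first by rewrite inE => /eqP->.
move=> /mem_patsS[t [k [/ih tn kn ->]]].
by rewrite mem_rcons inE => /predU1P[->//|/tn/ltnW].
Qed.

Lemma uniq_pats n : uniq (pats n).
Proof.
elim: n => // n ih; apply: allpairs_uniq => //; first exact: iota_uniq.
by move=> [s k] [t l] _ _ /= /rcons_inj [-> ->].
Qed.

Lemma canon_pats s : canon s -> s \in pats (size s).
Proof. by move=> /eqP {1}<-; exact: mem_pat. Qed.

(** * Sequences observed up to a given index *)

Section sequence_space.
Context {R : realType}.
Implicit Types (A : nat -> set R) (n : nat).

Definition rect n A : set (nat -> R) := [set x | forall i, (i < n)%N -> A i (x i)].

Definition rects n : set (set (nat -> R)) :=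
  [set rect n A | A in [set A | forall i, measurable (A i)]].

(* All of [nat -> R], but the measurable sets only depend on the first [n]
   coordinates. *)
Definition seqn n := g_sigma_algebraType (rects n).

Lemma measurable_rect n A :
  (forall i, measurable (A i)) -> measurable (rect n A : set (seqn n)).
Proof. by move=> mA; apply: sub_sigma_algebra; exists A. Qed.

Lemma rectT n : rect n (fun=> setT) = setT.
Proof. by apply/seteqP; split. Qed.

Lemma measurable_coord n i : (i < n)%N ->
  measurable_fun [set: seqn n] (fun x : seqn n => x i).
Proof.
move=> ni _ D mD; rewrite setTI.
rewrite (_ : _ @^-1` _ = rect n (fun k => if k == i then D else setT)).
  by apply: measurable_rect => k; case: ifP.
apply/seteqP; split => x /= xD; first by move=> k nk; case: ifP => // /eqP->.
by have := xD _ ni; rewrite eqxx.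
Qed.

(** Rectangles are stable under intersection and include the whole space, so the constant sequence
    [setT] serves as the exhaustion. *)
Lemma seqn_measure_unique n (m1 m2 : {measure set (seqn n) -> \bar R}) :
  (m1 setT < +oo)%E ->
  (forall A, (forall i, measurable (A i)) -> m1 (rect n A) = m2 (rect n A)) ->
  forall G, measurable G -> m1 G = m2 G.
Proof.
move=> m1T m12 G mG.
apply: (@measure_unique _ _ (seqn n) (rects n) (fun=> setT)) => //.
- move=> _ _ [A mA <-] [B mB <-]; exists (fun i => A i `&` B i).
    by move=> i; exact: measurableI.
  apply/seteqP; split => [x xAB|x [xA xB] i ni]; last by split; [exact: xA|exact: xB].
  by split => i /xAB[].
- by move=> _; exists (fun=> setT) => //; rewrite rectT.
- by rewrite bigcup_const.
- by move=> _ [A mA <-]; exact: m12.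
Qed.

End sequence_space.

Section random_sequences.
Context {d} {T : measurableType d} {R : realType}.
Implicit Types (X : nat -> T -> R) (n : nat).

Lemma measurable_seqn X n : (forall i, (i < n)%N -> measurable_fun setT (X i)) ->
  measurable_fun setT (fun w => X^~ w : seqn n).
Proof.
move=> mX; apply: (@measurability _ _ T (seqn n) setT _ (rects n)) => // _ [_ [A mA <-] <-].
rewrite setTI (_ : _ @^-1` _ = \bigcap_(i in `I_n) (X i @^-1` A i)); last first.
  by apply/seteqP; split.
apply: fin_bigcap_measurable; first exact: finite_II.
by move=> i /= ni; rewrite -[X in measurable X]setTI; exact: mX.
Qed.

Definition mseqn X n (mX : forall i, (i < n)%N -> measurable_fun setT (X i)) :
    {mfun T >-> seqn n} :=
  HB.pack (fun w => X^~ w : seqn n)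
    (isMeasurableFun.Build _ _ _ _ (fun w => X^~ w : seqn n) (measurable_seqn mX)).

(** A list that is not canonical is the pattern of no sequence, so its event is empty; otherwise
    finitely many conditions on pairs of coordinates describe the event. *)
Lemma measurable_pat X n s : (forall i, (i < n)%N -> measurable_fun setT (X i)) ->
  measurable [set w | pat n (X^~ w) = s].
Proof.
move=> mX; have [/eqP <-|sNpat] := boolP (pat n (nth 0%N s) == s); last first.
  rewrite (_ : mkset _ = set0)//; apply/seteqP; split => // w /= xs.
  move: sNpat; rewrite -xs; apply/negP; rewrite negbK.
  by have := pat_canon (X^~ w) n; rewrite /canon size_pat.
rewrite (_ : mkset _ = \bigcap_(i in `I_n) \bigcap_(k in `I_n)
    [set w | (X i w == X k w) = (nth 0%N s i == nth 0%N s k)]).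
  apply: fin_bigcap_measurable => [|i /= ni]; first exact: finite_II.
  apply: fin_bigcap_measurable => [|k /= nk]; first exact: finite_II.
  rewrite -[X in measurable X]setTI.
  exact: (measurable_fun_eqr (mX i ni) (mX k nk) measurableT) (set1 _) _.
apply/seteqP; split => w /=.
  by move=> /eq_pat h i /= ni k /= nk; exact: h.
by move=> h; apply: pat_ker => i k ni nk; exact: h.
Qed.

End random_sequences.

(** * Pushforward measures and comparison of events up to null sets *)

Definition push {d d'} {T : measurableType d} {T' : measurableType d'} {R : realType}
    (mu : {measure set T -> \bar R}) {f : T -> T'} (mf : measurable_fun setT f) :
    {measure set T' -> \bar R} :=
  measure_function_pushforward__canonical__measure_function_Measure mu mf.

Lemma le_measure_ae d (T : measurableType d) (R : realType)
    (mu : {measure set T -> \bar R}) (A B : set T) :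
  measurable A -> measurable B -> {ae mu, forall w, A w -> B w} ->
  (mu A <= mu B)%E.
Proof.
move=> mA mB [N [mN N0 AB]]; apply: (@le_trans _ _ (mu (B `|` N))).
  apply: le_measure; rewrite ?inE//; first exact: measurableU.
  move=> w Aw; have [Bw|nBw] := pselect (B w); first by left.
  by right; apply: AB => /= h; apply: nBw; exact: h.
by rewrite measureU0.
Qed.

Lemma eq_measure_ae d (T : measurableType d) (R : realType)
    (mu : {measure set T -> \bar R}) (A B : set T) :
  measurable A -> measurable B -> {ae mu, forall w, A w <-> B w} -> mu A = mu B.
Proof.
move=> mA mB AB; apply/eqP; rewrite eq_le !le_measure_ae//.
  by apply: filterS AB => w [].
by apply: filterS AB => w [].
Qed.

(** * The i.i.d. atoms *)

Section atoms.
Context {d} {T : measurableType d} {R : realType}.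
Variables (P : probability T R) (nu0 : probability R R) (eta : nat -> T -> R).
Hypothesis nu0_diffuse : forall x : R, nu0 [set x] = 0%E.
Hypothesis eta_meas : forall k, measurable_fun setT (eta k).
Hypothesis eta_iid : forall (n : nat) (C : nat -> set R),
  (forall k, measurable (C k)) ->
  P [set w | forall k, (k < n)%N -> C k (eta k w)] = (\prod_(k < n) nu0 (C k))%E.

Lemma atoms_rect (g : nat -> nat) n M (A : nat -> set R) :
  (forall i, measurable (A i)) -> (forall i, (i < n)%N -> (g i < M)%N) ->
  P [set w | forall i, (i < n)%N -> A i (eta (g i) w)] =
  (\prod_(k < M) nu0 (\bigcap_(i in [set i | (i < n)%N /\ g i = k]) A i))%E.
Proof.
move=> mA gM.
rewrite -(@eta_iid M (fun k => \bigcap_(i in [set i | (i < n)%N /\ g i = k]) A i)) => [|k].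
  congr (P _); apply/seteqP; split => w /= wA.
    by move=> k kM i /= [ni gik]; rewrite -gik; exact: wA.
  by move=> i ni; apply: (wA (g i)) => //; exact: gM.
apply: fin_bigcap_measurable => //.
by apply: (@sub_finite_set _ _ `I_n) => // i [].
Qed.

(** Values outside the image of [g] contribute a factor one, and each value in the image is
    represented by the least index of its fibre; the indexing no longer depends on [M]. *)
Lemma prode_fibers (g : nat -> nat) n M (F : nat -> \bar R) :
  (forall i, (i < n)%N -> (g i < M)%N) ->
  (forall k, (forall i, (i < n)%N -> g i <> k) -> F k = 1%E) ->
  (\prod_(k < M) F k = \prod_(i <- iota 0 n | lab g i == i) F (g i))%E.
Proof.
move=> gM F1; rewrite -(big_mkord xpredT) /index_iota subn0.
rewrite (bigID (mem [seq g i | i <- iota 0 n]))/= [X in (_ * X)%E]big1 ?mule1; last first.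
  move=> k /mapP kg; apply: F1 => i ni gik; apply: kg.
  by exists i; rewrite ?mem_iota.
rewrite -big_filter -[RHS]big_filter -(big_map g xpredT).
apply: perm_big; apply: uniq_perm.
- by rewrite filter_uniq// iota_uniq.
- rewrite map_inj_in_uniq ?filter_uniq ?iota_uniq// => i k.
  rewrite !mem_filter => /andP[/eqP li _] /andP[/eqP lk _] gik.
  by rewrite -li -lk; apply/eqP; rewrite labE gik.
- move=> k; rewrite mem_filter; apply/andP/mapP.
    move=> [/mapP[i]]; rewrite mem_iota add0n => /= ni -> _.
    exists (lab g i); last by rewrite lab_eq.
    by rewrite mem_filter labE lab_eq eqxx mem_iota/= (leq_ltn_trans (lab_le g i)).
  move=> [i]; rewrite mem_filter mem_iota/= add0n => /andP[_ ni] ->.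
  by rewrite mem_iota/= add0n gM//; split => //; apply: map_f; rewrite mem_iota.
Qed.

(** By independence the probability is a product over blocks of ties, and since the atoms share one
    law it does not matter which atom a block receives. *)
Lemma atoms_relabel (g h : nat -> nat) n (A : nat -> set R) :
  (forall i, measurable (A i)) -> pat n g = pat n h ->
  P [set w | forall i, (i < n)%N -> A i (eta (g i) w)] =
  P [set w | forall i, (i < n)%N -> A i (eta (h i) w)].
Proof.
move=> mA /eq_pat gh.
have byblock (f : nat -> nat) :
    P [set w | forall i, (i < n)%N -> A i (eta (f i) w)] =
    (\prod_(i <- iota 0 n | lab f i == i)
       nu0 (\bigcap_(k in [set k | (k < n)%N /\ f k = f i]) A k))%E.
  have fM i : (i < n)%N -> (f i < \max_(k < n) (f k).+1)%N.
    by move=> ni; exact: (@leq_bigmax _ (fun k : 'I_n => (f k).+1) (Ordinal ni)).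
  rewrite (atoms_rect mA fM).
  rewrite (@prode_fibers f n _ (fun l => nu0
    (\bigcap_(k in [set k | (k < n)%N /\ f k = l]) A k)))// => l fl.
  rewrite -[RHS](probability_setT nu0); congr (nu0 _).
  by apply/seteqP; split => // x _ i /= [/fl].
rewrite !byblock.
rewrite big_seq_cond [RHS]big_seq_cond; apply: eq_big => [i|i].
  rewrite mem_iota/= add0n; case: ltnP => //= ni.
  by rewrite (lab_ker gh).
rewrite mem_iota/= add0n => /andP[ni _]; congr (nu0 _).
apply: eq_bigcapl; split=> k -[nk /eqP gki]; split=> //; apply/eqP.
  by rewrite -gh.
by rewrite gh.
Qed.

(** For fixed [C] both sides are finite measures in [G], and they agree on rectangles. *)
Lemma atoms_indep n (G : set (seqn n)) (C : set R) :
  measurable G -> measurable C ->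
  P [set w | G (eta^~ w) /\ C (eta n w)] = (P [set w | G (eta^~ w)] * nu0 C)%E.
Proof.
move=> mG mC.
have meta i : (i < n)%N -> measurable_fun setT (eta i) by move=> _; exact: eta_meas.
have mCn : measurable (eta n @^-1` C).
  by rewrite -[X in measurable X]setTI; exact: eta_meas.
pose Y := mseqn meta.
have nu0C : nu0 C = (NngNum (fine_ge0 (measure_ge0 nu0 C)))%:num%:E.
  by rewrite /= fineK// fin_num_measure.
pose m1 : {measure set (seqn n) -> \bar R} :=
  push (mrestr P mCn) (@measurable_funPT _ _ _ _ Y).
pose m2 : {measure set (seqn n) -> \bar R} :=
  mscale (NngNum (fine_ge0 (measure_ge0 nu0 C))) (distribution P Y).
rewrite [RHS]muleC; have := @seqn_measure_unique _ n m1 m2 _ _ G mG.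
rewrite /m1 /m2 /= /pushforward/mrestr/mscale/=/distribution/pushforward -nu0C.
apply.
- by rewrite preimage_setT setTI (le_lt_trans (probability_le1 _ _)) ?ltry.
- move=> A mA.
  rewrite (_ : _ `&` _ = [set w | forall k, (k < n.+1)%N ->
      (if (k < n)%N then A k else C) (eta k w)]).
    rewrite (@eta_iid n.+1 (fun k => if (k < n)%N then A k else C)) => [|k];
      last by case: ifP.
    rewrite big_ord_recr/= ltnn muleC; congr (_ * _)%E.
    transitivity (P [set w | forall k, (k < n)%N -> A k (eta k w)]) => //.
    by rewrite (@eta_iid n A)//; apply: eq_bigr => i _; rewrite ltn_ord.
  apply/seteqP; split => w /=.
    move=> [wA wC] k; rewrite ltnS leq_eqVlt => /predU1P[->|kn]; first by rewrite ltnn.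
    by rewrite kn; exact: wA.
  move=> h; split; last by have := h n; rewrite ltnn; apply.
  by move=> k kn; have := h k; rewrite kn; apply; exact: ltnW.
Qed.

(** Integrates out a fresh atom. This serves twice: to exclude ties between atoms, and to produce
    the distribution function of [nu0] in the prediction rule. *)
Lemma atoms_fubini n (H : set (seqn n * R)) : measurable H ->
  P [set w | H (eta^~ w, eta n w)] = (\int[P]_w nu0 (xsection H (eta^~ w)))%E.
Proof.
move=> mH.
have meta i : (i < n)%N -> measurable_fun setT (eta i) by move=> _; exact: eta_meas.
pose Y := mseqn meta.
have mYe : measurable_fun setT (fun w => (eta^~ w : seqn n, eta n w)).
  by apply: measurable_fun_pair; [exact: measurable_seqn|exact: eta_meas].
pose m' : {measure set (seqn n * R) -> \bar R} :=
  push P mYe.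
have := @product_measure_unique _ _ (seqn n) R R (distribution P Y) nu0 m' _ H mH.
rewrite /m' /= /pushforward/= => <-.
  rewrite /product_measure1 ge0_integral_pushforward//.
  exact: measurable_fun_xsection.
by move=> A B mA mB; rewrite -atoms_indep.
Qed.

(** Each section of the diagonal is a single point, which [nu0] does not charge. *)
Lemma atoms_neq i k : i != k -> P [set w | eta i w = eta k w] = 0%E.
Proof.
wlog ik : i k / (i < k)%N => [h|_].
  rewrite neq_ltn => /orP[ik|ki]; first by apply: h; rewrite // neq_ltn ik.
  rewrite (_ : mkset _ = [set w | eta k w = eta i w]).
    by apply: h; rewrite // neq_ltn ki.
  by apply/seteqP; split => w /= ->.
pose H : set (seqn k * R) := [set z | z.1 i == z.2].
rewrite (_ : mkset _ = [set w | H (eta^~ w, eta k w)]); last first.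
  by apply/seteqP; split => w /= /eqP.
rewrite atoms_fubini.
  rewrite integral0_eq// => w _; rewrite -[RHS](nu0_diffuse (eta i w)).
  congr (nu0 _); apply/seteqP; split => y; rewrite /xsection/= inE /H/=.
    by move=> /eqP.
  by move=> ->.
rewrite -[X in measurable X]setTI.
have mH : measurable_fun setT (fun z : seqn k * R => z.1 i == z.2).
  apply: measurable_fun_eqr; last exact: measurable_snd.
  exact: (measurableT_comp (measurable_coord ik) measurable_fst).
exact: (mH measurableT (set1 true)).
Qed.

Lemma atoms_distinct : {ae P, forall w, forall i k, eta i w == eta k w -> i = k}.
Proof.
apply: ae_foralln => i; apply: ae_foralln => k.
have [->|ik] := eqVneq i k; first by apply: aeW.
exists [set w | eta i w = eta k w]; split; last 2 first.
- exact: atoms_neq.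
- move=> w /= nik; apply: contrapT => h; apply: nik => /eqP; exact: contraPP.
have /(_ measurableT (set1 true)) := measurable_fun_eqr (eta_meas i) (eta_meas k).
rewrite setTI (_ : _ @^-1` _ = [set w | eta i w = eta k w]); first exact.
by apply/seteqP; split => w /= /eqP.
Qed.

Let atom_meas (s : seq nat) n i : (i < n)%N -> measurable_fun setT (eta (nth 0%N s i)).
Proof. by move=> _; exact: eta_meas. Qed.

Lemma atoms_pat s : canon s ->
  {ae P, forall w, pat (size s) (fun i => eta (nth 0%N s i) w) = s}.
Proof.
move=> /eqP cs; apply: filterS atoms_distinct => w winj.
rewrite -[RHS]cs; apply: pat_ker => i k _ _.
by apply/idP/idP => [/winj ->//|/eqP->].
Qed.

Lemma measurable_atoms n s (G : set (seqn n)) : measurable G ->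
  measurable [set w | G (fun i => eta (nth 0%N s i) w)].
Proof.
move=> mG; rewrite -[X in measurable X]setTI.
exact: (measurable_seqn (@atom_meas s n)).
Qed.

Lemma mixture_law (X : nat -> T -> R) n (q : seq nat -> \bar R) :
  (forall i, (i < n)%N -> measurable_fun setT (X i)) -> (forall s, 0 <= q s)%E ->
  (forall A, (forall i, measurable (A i)) ->
     P [set w | forall i, (i < n)%N -> A i (X i w)] =
     (\sum_(s <- pats n | canon s)
        q s * P [set w | forall i, (i < n)%N -> A i (eta (nth 0%N s i) w)])%E) ->
  forall G : set (seqn n), measurable G ->
    P [set w | G (X^~ w)] =
    (\sum_(s <- pats n | canon s) q s * P [set w | G (fun i => eta (nth 0%N s i) w)])%E.
Proof.
move=> mX q0 lawX G mG.
(* With every [A i] the whole space, the mixture formula says that the coefficients sum to one;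
   hence they are finite and may scale measures. *)
have q1 s : s \in pats n -> canon s -> (q s <= 1)%E.
  move=> sn cs; rewrite -(probability_setT P).
  rewrite (_ : setT = [set w | forall i, (i < n)%N -> setT (X i w)]); last first.
    by apply/seteqP; split.
  rewrite (lawX (fun=> setT))// -big_filter.
  rewrite (bigD1_seq s) ?filter_uniq ?uniq_pats ?mem_filter ?cs//=.
  rewrite (_ : mkset _ = setT); last by apply/seteqP; split.
  rewrite [P setT]probability_setT mule1 leeDl// sume_ge0// => t _.
  by rewrite mule_ge0.
pose ps := [seq s <- pats n | canon s].
have qE k : (k < size ps)%N -> (fine (q (nth [::] ps k)))%:E = q (nth [::] ps k).
  move=> kps; have := mem_nth [::] kps; rewrite mem_filter => /andP[cs sn].
  by rewrite fineK// ge0_fin_numE// (le_lt_trans (q1 _ sn cs))// ltry.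
pose Y s := mseqn (@atom_meas s n).
pose m2 : {measure set (seqn n) -> \bar R} :=
  msum (fun k => mscale (NngNum (fine_ge0 (q0 (nth [::] ps k))))
                        (distribution P (Y (nth [::] ps k)))) (size ps).
have m2E B : m2 B = (\sum_(s <- pats n | canon s)
    q s * P [set w | B (fun i => eta (nth 0%N s i) w)])%E.
  rewrite -big_filter -/ps (big_nth [::]) big_mkord /m2/= /msum.
  by apply: eq_bigr => k _; rewrite /mscale -[in RHS]qE.
rewrite -m2E; apply: (@seqn_measure_unique _ n (distribution P (mseqn mX)) m2) => //.
  by rewrite (le_lt_trans (probability_le1 _ _)) ?ltry.
by move=> A mA; rewrite m2E -lawX.
Qed.

(* Since the atoms are almost surely distinct, the component [s] of the mixture
   lives on the event that the pattern is [s]. *)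
Lemma mixture_pat (X : nat -> T -> R) n (q : seq nat -> \bar R) :
  (forall i, (i < n)%N -> measurable_fun setT (X i)) -> (forall s, 0 <= q s)%E ->
  (forall A, (forall i, measurable (A i)) ->
     P [set w | forall i, (i < n)%N -> A i (X i w)] =
     (\sum_(s <- pats n | canon s)
        q s * P [set w | forall i, (i < n)%N -> A i (eta (nth 0%N s i) w)])%E) ->
  forall s (G : set (seqn n)), canon s -> size s = n -> measurable G ->
    P [set w | pat n (X^~ w) = s /\ G (X^~ w)] =
    (q s * P [set w | G (fun i => eta (nth 0%N s i) w)])%E.
Proof.
move=> mX q0 lawX s G cs sn mG.
have mpat : measurable ([set x : nat -> R | pat n x = s] : set (seqn n)).
  exact: (@measurable_pat _ (seqn n) R (fun i (x : seqn n) => x i) n s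
    (fun i ni => measurable_coord ni)).
have mGs : measurable ([set x : nat -> R | pat n x = s] `&` G : set (seqn n)).
  exact: measurableI.
rewrite (mixture_law mX q0 lawX mGs).
rewrite -big_filter (bigD1_seq s) ?filter_uniq ?uniq_pats ?mem_filter//=; last first.
  by rewrite cs/= -sn canon_pats.
rewrite [X in (_ + X)%E]big1_seq ?adde0 => [|t /=]; last first.
  rewrite mem_filter => /andP[ts /andP[ct tn]].
  rewrite (_ : P _ = 0%E) ?mule0//; apply/eqP; rewrite eq_le measure_ge0 andbT.
  rewrite -(measure0 P); apply: (@le_measure_ae _ T R P _ set0);
    [exact: (@measurable_atoms n t _ mGs)|by []|].
  apply: filterS (atoms_pat ct) => w; rewrite (size_pats tn) => wt [ws _].
  by move: ts; rewrite -wt ws eqxx.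
congr (_ * _)%E; apply: eq_measure_ae;
  [exact: (@measurable_atoms n s _ mGs)|exact: measurable_atoms|].
by apply: filterS (atoms_pat cs) => w; rewrite sn => ws; split => [[]|].
Qed.

End atoms.

(** * Integrals *)

Section integral_lemmas.
Context {d} {T : measurableType d} {R : realType}.
Implicit Types (mu : {measure set T -> \bar R}) (f g : T -> \bar R).
Local Open Scope ereal_scope.
Import HBNNSimple.

(** Cutting a simple function below [f] off on the null set keeps its integral and puts it below
    [g], so the comparison takes place inside the suprema defining the integrals. *)
Let le_nnintegral_ae mu (N : set T) f g : measurable N -> mu N = 0 ->
  (forall w, 0 <= f w) -> (forall w, 0 <= g w) -> (forall w, ~ N w -> f w <= g w) ->
  \int[mu]_w f w <= \int[mu]_w g w.
Proof.
move=> mN N0 f0 g0 fg; rewrite [leLHS]ge0_integralTE// [leRHS]ge0_integralTE//.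
apply: ge_ereal_sup => _ [h hf <-].
have mNc := measurableC mN.
apply: (@le_trans _ _ (sintegral mu (proj_nnsfun h mNc))).
  rewrite -!integralT_nnsfun le_eqVlt; apply/orP; left; apply/eqP.
  apply: ae_eq_integral => //.
  - by apply/measurable_EFinP.
  - by apply/measurable_EFinP.
  - exists N; split => // w /= wN; apply: contrapT => Nw; apply: wN => _.
    by rewrite mindicE mem_set// mulr1.
apply: ereal_sup_ubound; exists (proj_nnsfun h mNc) => //= w.
rewrite mindicE; have [wN|wN] := pselect (N w).
  by rewrite memNset ?mulr0//= => /(_ wN).
by rewrite mem_set// mulr1 (le_trans (hf w))// fg.
Qed.

(* No measurability: [ssp_nu] involves a series of junk value wherever the
   weights have no sum. *)
Lemma eq_integral_ae mu f g :
  {ae mu, forall w, f w = g w} -> \int[mu]_w f w = \int[mu]_w g w.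
Proof.
move=> [N [mN N0 fg]].
have {}fg w : ~ N w -> f w = g w by move=> Nw; apply: contrapT => /fg.
have key (h k : T -> \bar R) : (forall w, 0 <= h w) -> (forall w, 0 <= k w) ->
    (forall w, ~ N w -> h w = k w) -> \int[mu]_w h w = \int[mu]_w k w.
  move=> h0 k0 hk; apply/eqP; rewrite eq_le.
  by rewrite !(le_nnintegral_ae mN N0)// => w /hk->.
rewrite integralE [RHS]integralE; congr (_ - _); apply: key => // w /fg.
  by rewrite !funeposE => ->.
by rewrite !funenegE => ->.
Qed.

Lemma ge0_integral_mrestr mu (E : set T) (mE : measurable E) f :
  measurable_fun setT f -> (forall w, 0 <= f w) ->
  \int[mrestr mu mE]_w f w = \int[mu]_(w in E) f w.
Proof.
move=> mf f0; rewrite -(setUv E) ge0_integral_setU//; last 3 first.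
- exact: measurableC.
- by rewrite setUv.
- by apply/disj_setPS => w [].
rewrite [X in _ + X]null_set_integral ?adde0//.
- apply: eq_measure_integral => A mA AE.
  by rewrite /= /mrestr setIidl.
- exact: measurableC.
- exact: measurable_funTS.
- by rewrite /= /mrestr setICl measure0.
Qed.

(** Raises an identity between probabilities of events to one between integrals; it is applied to
    the independence of weights and atoms and to the law given a pattern. *)
Lemma integral_transfer d' (T' : measurableType d') mu (E : set T)
    (phi psi : T -> T') (c : R) (h : T' -> \bar R) :
  measurable E -> measurable_fun setT phi -> measurable_fun setT psi -> (0 <= c)%R ->
  (forall G, measurable G -> mu (E `&` phi @^-1` G) = c%:E * mu (psi @^-1` G)) ->
  measurable_fun setT h -> (forall x, 0 <= h x) ->
  \int[mu]_(w in E) h (phi w) = c%:E * \int[mu]_w h (psi w).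
Proof.
move=> mE mphi mpsi c0 muE mh h0.
rewrite -ge0_integral_mrestr//; last exact: measurableT_comp.
pose m1 := push (mrestr mu mE) mphi.
pose m2 := push mu mpsi.
transitivity (\int[m1]_x h x).
  by rewrite ge0_integral_pushforward.
transitivity (\int[mscale (NngNum c0) m2]_x h x).
  apply: eq_measure_integral => A mA _.
  by rewrite /m1/= /mscale/= /pushforward /mrestr/= setIC muE.
rewrite ge0_integral_mscale//; congr (_ * _).
by rewrite ge0_integral_pushforward.
Qed.

End integral_lemmas.

(** For an infinite factor, one nonzero term makes both sides infinite, and without such a term both
    vanish. *)
Lemma ge0_nneseriesZl (R : realType) (f : nat -> \bar R) (x : \bar R) :
  (0 <= x)%E -> (forall k, 0 <= f k)%E ->
  (\sum_(0 <= k <oo) x * f k = x * \sum_(0 <= k <oo) f k)%E.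
Proof.
move=> x0 f0; case: x x0 => [r _|_|//]; first exact: nneseriesZl.
have [f_0|/existsNP[k /eqP fk]] := pselect (forall k, f k = 0%E).
  by rewrite !eseries0 ?mule0// => k _ _; rewrite f_0 ?mule0.
have fk0 : (0 < f k)%E by rewrite lt_def fk f0.
rewrite (@nneseries_pinfty _ (fun i => +oo * f i)%E xpredT k)//.
- rewrite (@nneseriesD1 _ f k)// gt0_mulye// (lt_le_trans fk0)// leeDl//.
  exact: nneseries_ge0.
- by move=> n _; rewrite mule_ge0.
- by rewrite gt0_mulye.
Qed.

Lemma emeasurable_prod d (T : measurableType d) (R : realType)
    (F : nat -> T -> \bar R) m n :
  (forall i, measurable_fun setT (F i)) ->
  measurable_fun setT (fun w => \prod_(m <= i < n) F i w)%E.
Proof.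
move=> mF; rewrite /index_iota; elim: (iota _ _) => [|i s ih].
  by under eq_fun do rewrite big_nil; exact: measurable_cst.
by under eq_fun do rewrite big_cons; exact: emeasurable_funM.
Qed.

(** * Moments of a species sampling process *)

Section species_sampling.
Context {d} {T : measurableType d} {R : realType}.
Variables (P : probability T R) (nu0 : probability R R) (p eta : nat -> T -> R).
Hypothesis p_meas : forall k, measurable_fun setT (p k).
Hypothesis eta_meas : forall k, measurable_fun setT (eta k).
Hypothesis p_ae : {ae P, forall w, (forall k, 0 <= p k w) /\
                                   (\sum_(0 <= k <oo) (p k w)%:E <= 1)%E}.
Hypothesis p_eta_indep : forall A B, sigma_rv p setT A -> sigma_rv eta setT B ->
                                     P (A `&` B) = (P A * P B)%E.
Hypothesis eta_iid : forall (n : nat) (C : nat -> set R),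
  (forall k, measurable (C k)) ->
  P [set w | forall k, (k < n)%N -> C k (eta k w)] = (\prod_(k < n) nu0 (C k))%E.
Local Open Scope ereal_scope.
Implicit Types (ks : seq (option nat)) (A : nat -> set R).

(* [Some i] is the i-th atom and [None] the diffuse part; truncating the weights
   makes them nonnegative everywhere, at the cost of a null set. *)
Let wgt (k : option nat) (w : T) : \bar R :=
  if k is Some i then (Num.max 0 (p i w))%R%:E
  else maxe 0 (1 - \sum_(0 <= i <oo) (Num.max 0 (p i w))%R%:E).

Let atm (k : option nat) (C : set R) (w : T) : \bar R :=
  if k is Some i then (\1_C (eta i w))%:E else nu0 C.

Let ssp (w : T) (C : set R) : \bar R :=
  \sum_(0 <= i <oo) wgt (Some i) w * atm (Some i) C w + wgt None w * atm None C w.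

Let wgt_ge0 k w : 0 <= wgt k w.
Proof. by case: k => [i|]; rewrite /wgt ?lee_fin le_max lexx. Qed.

Let atm_ge0 k C w : 0 <= atm k C w.
Proof. by case: k => [i|]; rewrite /atm// indicE lee_fin ler0n. Qed.

Let ssp_ge0 w C : 0 <= ssp w C.
Proof.
by apply: adde_ge0; [apply: nneseries_ge0 => n _ _|]; exact: mule_ge0.
Qed.

Lemma ssp_nu_ae : {ae P, forall w, forall C, ssp_nu nu0 p eta w C = ssp w C}.
Proof.
apply: filterS p_ae => w [p0 p1] C; rewrite /ssp_nu /ssp /wgt /atm.
have maxp i : Num.max 0%R (p i w) = p i w by apply/max_idPr.
under [in RHS]eq_eseriesr do rewrite maxp.
under [X in maxe _ (_ - X)]eq_eseriesr do rewrite maxp.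
congr (_ + _ * _); apply/esym/max_idPr.
by rewrite sube_ge0// orbT.
Qed.

(** The domain is abstract so that one proof covers both [T] and the same set with the sigma-algebra
    generated by the weights. *)
Let mwgt d' (T' : measurableType d') (u : T' -> T) :
  (forall i, measurable_fun setT (p i \o u)) ->
  forall k, measurable_fun setT (wgt k \o u).
Proof.
move=> mp [i|].
  apply/measurable_EFinP; apply: (measurable_maxr _ (mp i)).
  exact: measurable_cst.
apply: measurable_maxe => //; apply: emeasurable_funB => //.
apply: ge0_emeasurable_sum => [i w _ _|i _]; first by rewrite lee_fin le_max lexx.
by apply/measurable_EFinP; apply: (measurable_maxr _ (mp i)); exact: measurable_cst.
Qed.

Let matm k C : measurable C -> measurable_fun setT (atm k C).
Proof.
move=> mC; case: k => [i|]; last exact: measurable_cst.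
by apply/measurable_EFinP; exact: measurableT_comp (eta_meas i).
Qed.

Let mterm k C : measurable C -> measurable_fun setT (fun w => wgt k w * atm k C w).
Proof.
move=> mC; apply: emeasurable_funM; last exact: matm.
exact: (@mwgt _ T id p_meas).
Qed.

Let mssp C : measurable C -> measurable_fun setT (ssp^~ C).
Proof.
move=> mC; apply: emeasurable_funD; last exact: mterm.
by apply: ge0_emeasurable_sum => [i w _ _|i _]; [exact: mule_ge0|exact: mterm].
Qed.

Let prod_ind (s : seq nat) (Q : pred nat) (E : nat -> set T) w :
  \prod_(i <- s | Q i) (\1_(E i) w)%:E =
  (\1_[set w | forall i, i \in s -> Q i -> E i w] w)%:E :> \bar R.
Proof.
elim: s => [|i s ih]; first by rewrite big_nil indicE mem_set// => i.
rewrite big_cons ih; case: ifPn => Qi; last first.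
  congr (_%:E); rewrite !indicE; congr (_%:R); congr nat_of_bool; apply/idP/idP.
    rewrite !inE/= => h j; rewrite inE => /predU1P[->|/h//].
    by rewrite (negPf Qi).
  by rewrite !inE/= => h j js; apply: h; rewrite inE js orbT.
rewrite -EFinM !indicE -natrM mulnb; congr (_%:R%:E); congr nat_of_bool.
apply/andP/idP.
  by rewrite !inE/= => -[Ei h] j; rewrite inE => /predU1P[->//|/h].
rewrite !inE/= => h; split; first by apply: h => //; rewrite mem_head.
by move=> j js; apply: h; rewrite inE js orbT.
Qed.

(** The identity, seen as a map into the coarser space generated by the weights, turns independence
    of events into the hypothesis of [integral_transfer]. *)
Let indep_integral (E : set T) (f : T -> \bar R) :
  sigma_rv eta setT E ->
  measurable_fun setT (f : g_sigma_algebraType [set S | exists i (D : set R),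
    setT i /\ measurable D /\ S = p i @^-1` D] -> \bar R) ->
  (forall w, 0 <= f w) ->
  \int[P]_(w in E) f w = P E * \int[P]_w f w.
Proof.
move=> sE mf f0.
have mE : measurable E.
  apply: (smallest_sub _ _ sE); first exact: sigma_algebra_measurable.
  move=> _ [i [D [_ [mD ->]]]]; rewrite -[X in measurable X]setTI.
  exact: eta_meas.
have mid : measurable_fun setT (id : T -> g_sigma_algebraType [set S | exists i (D : set R),
    setT i /\ measurable D /\ S = p i @^-1` D]).
  move=> _ B mB; rewrite setTI.
  apply: (smallest_sub _ _ mB); first exact: sigma_algebra_measurable.
  move=> _ [i [D [_ [mD ->]]]]; rewrite -[X in measurable X]setTI.
  exact: p_meas.
have PE : (fine (P E))%:E = P E by rewrite fineK// fin_num_measure.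
rewrite -PE (@integral_transfer _ _ _ _ _ P E _ _ (fine (P E)) _ mE mid mid)//.
  exact: fine_ge0.
by move=> G mG; rewrite PE setIC muleC; exact: p_eta_indep.
Qed.

(* Realizing each factor [nu0 (A i)] by a fresh atom, beyond the bound [M] of the
   indices in use, turns a monomial into an event about the atoms only. *)
Let monomial_mixture ks (n := size ks) (a := nth None ks) : exists q s,
  [/\ 0 <= q, canon s, size s = n & forall A, (forall i, measurable (A i)) ->
    \int[P]_w \prod_(0 <= i < n) (wgt (a i) w * atm (a i) (A i) w) =
    q * P [set w | forall i, (i < n)%N -> A i (eta (nth 0%N s i) w)]].
Proof.
pose M := (\max_(i < n) (odflt 0 (a i)).+1)%N.
have aM i k : (i < n)%N -> a i = Some k -> (k < M)%N.
  move=> ni aik; have := @leq_bigmax _ (fun i : 'I_n => (odflt 0 (a i)).+1)%N (Ordinal ni).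
  by rewrite /= aik.
pose g i := if a i is Some k then k else (M + i)%N.
exists (\int[P]_w \prod_(0 <= i < n) wgt (a i) w), (pat n g); split.
- by apply: integral_ge0 => w _; exact: prode_ge0.
- exact: pat_canon.
- exact: size_pat.
move=> A mA.
pose E := [set w | forall i, (i < n)%N -> a i != None -> A i (eta (odflt 0%N (a i)) w)].
pose c := \prod_(0 <= i < n | a i == None) nu0 (A i).
have c0 : 0 <= c by apply: prode_ge0.
have atmE w : \prod_(0 <= i < n) atm (a i) (A i) w = c * (\1_E w)%:E.
  rewrite (bigID (fun i => a i == None))/=; congr (_ * _).
    by apply: eq_bigr => i /eqP; rewrite /atm => ->.
  rewrite (eq_bigr (fun i => (\1_(eta (odflt 0%N (a i)) @^-1` A i) w)%:E)).
    rewrite prod_ind; congr (_%:E); rewrite !indicE; congr (_%:R).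
    congr nat_of_bool; apply/idP/idP; rewrite !inE => h i.
      by move=> ni; apply: h; rewrite mem_index_iota.
    by rewrite mem_index_iota => ni; exact: h.
  by move=> i; rewrite /atm; case: (a i).
have sE : sigma_rv eta setT E.
  have -> : E = \bigcap_(i in `I_n) (if a i is Some k then eta k @^-1` A i else setT).
    apply/seteqP; split => w /= wE i ni; have := wE i ni; case: (a i) => //=.
    by move=> k; apply.
  pose Tn := g_sigma_algebraType [set S | exists i (D : set R),
    setT i /\ measurable D /\ S = eta i @^-1` D].
  apply: (@fin_bigcap_measurable _ Tn) => [|i _]; first exact: finite_II.
  case: (a i) => [k|]; last exact: measurableT.
  apply: sub_sigma_algebra.
  by exists k, (A i).
pose Tp := g_sigma_algebraType [set S | exists i (D : set R),
  setT i /\ measurable D /\ S = p i @^-1` D].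
have mw : measurable_fun setT (fun w : Tp => \prod_(0 <= i < n) wgt (a i) w).
  apply: (@emeasurable_prod _ Tp) => i; apply: (@mwgt _ Tp id) => k _ D mD.
  by rewrite setTI; apply: sub_sigma_algebra; exists k, D.
under eq_integral do rewrite big_split/= atmE muleCA.
have mprodw : measurable_fun setT (fun w => \prod_(0 <= i < n) wgt (a i) w).
  by apply: emeasurable_prod => i; exact: (@mwgt _ T id p_meas).
have mE : measurable E.
  apply: (smallest_sub _ _ sE); first exact: sigma_algebra_measurable.
  move=> _ [i [D [_ [mD ->]]]]; rewrite -[X in measurable X]setTI.
  exact: eta_meas.
rewrite ge0_integralZl//; last 2 first.
- apply: emeasurable_funM => //; apply/measurable_EFinP.
  exact: measurable_indic.
- by move=> w _; rewrite mule_ge0 ?prode_ge0// indicE lee_fin ler0n.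
transitivity (c * \int[P]_w ((fun w => \prod_(0 <= i < n) wgt (a i) w) \_ E) w).
  by congr (_ * _); apply: eq_integral => w _; rewrite epatch_indic.
rewrite -integral_mkcond (indep_integral sE mw); last first.
  by move=> w; exact: prode_ge0.
rewrite muleA muleC; congr (_ * _).
pose C k := \bigcap_(i in [set i | (i < n)%N /\ g i = k]) A i.
have mC k : measurable (C k).
  apply: fin_bigcap_measurable => //.
  by apply: (@sub_finite_set _ _ `I_n) => // i [].
have gs i : (i < n)%N -> (g i < M + n)%N.
  move=> ni; rewrite /g; case aiE : (a i) => [k|]; last by rewrite ltn_add2l.
  by rewrite (leq_trans (aM _ _ ni aiE))// leq_addr.
(* Back from canonical labels to [g], which keeps the atoms in use below [M] and places the fresh
   ones at [M + i], one per diffuse factor. *)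
rewrite -(@atoms_relabel _ _ _ _ _ _ eta_iid g); last 2 first.
- exact: mA.
- by have := pat_canon g n; rewrite /canon size_pat => /eqP.
(* Below [M] the fibres give the event [E]. Index [M + i] gives [nu0 (A i)] if factor [i] is
   diffuse; otherwise its fibre is empty and it gives one. *)
rewrite (atoms_rect eta_iid mA gs) big_split_ord/= muleC; congr (_ * _).
  rewrite -(@eta_iid M C)//; congr (P _); apply/seteqP; split => w /= wE.
    move=> k kM i /= [ni gik]; move: gik; rewrite /g.
    case aiE : (a i) => [l|]; last by move=> Mk; move: kM; rewrite -Mk ltnNge leq_addr.
    by move=> <-; have := wE i ni; rewrite aiE; apply.
  move=> i ni; case aiE : (a i) => [l|]// _ /=.
  by apply: (wE l (aM _ _ ni aiE)); split => //; rewrite /g aiE.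
rewrite /c big_mkcond big_mkord; apply: eq_bigr => i _; case: ifPn => [/eqP|] ai.
  congr (nu0 _); apply/seteqP; split => [x Aix l /= [nl]|x]; last first.
    by apply; split => //; rewrite /g ai.
  rewrite /g; case al : (a l) => [k|].
    by move=> kM; have := aM _ _ nl al; rewrite kM ltnNge leq_addr.
  by move=> /addnI ->.
rewrite -[LHS](probability_setT nu0); congr (nu0 _).
apply/seteqP; split => // x _ l /= [nl]; rewrite /g; case al : (a l) => [k|].
  by move=> kM; have := aM _ _ nl al; rewrite kM ltnNge leq_addr.
by move=> /addnI li; move: ai; rewrite -li al.
Qed.

(** Recording only that coefficients independent of [A] exist makes this class stable under sums and
    countable series. They are extended reals because a series of them could a priori diverge. *)
Let mixture n (m : (nat -> set R) -> \bar R) := exists2 q : seq nat -> \bar R,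
  (forall s, 0 <= q s) & (forall A, (forall i, measurable (A i)) ->
    m A = \sum_(s <- pats n | canon s)
            q s * P [set w | forall i, (i < n)%N -> A i (eta (nth 0%N s i) w)]).

Let mixture_eq n m m' : (forall A, (forall i, measurable (A i)) -> m A = m' A) ->
  mixture n m' -> mixture n m.
Proof. by move=> mm' [q q0 mq]; exists q => // A mA; rewrite mm'// mq. Qed.

Let mixtureD n m m' : mixture n m -> mixture n m' ->
  mixture n (fun A => m A + m' A).
Proof.
move=> [q q0 mq] [q' q'0 mq']; exists (fun s => q s + q' s) => [s|A mA].
  exact: adde_ge0.
rewrite mq// mq'// -big_split/=; apply: eq_bigr => s _.
by rewrite ge0_muleDl.
Qed.

Let mixture_series n (m : nat -> (nat -> set R) -> \bar R) :
  (forall k, mixture n (m k)) -> mixture n (fun A => \sum_(0 <= k <oo) m k A).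
Proof.
move=> mm; pose q k := s2val (cid2 (mm k)).
have q0 k s : 0 <= q k s by exact: (s2valP (cid2 (mm k))).
exists (fun s => \sum_(0 <= k <oo) q k s) => [s|A mA].
  by apply: nneseries_ge0 => k _ _.
transitivity (\sum_(0 <= k <oo) \sum_(s <- pats n | canon s)
   q k s * P [set w | forall i, (i < n)%N -> A i (eta (nth 0%N s i) w)]).
  by apply: eq_eseriesr => k _; exact: (s2valP' (cid2 (mm k))).
rewrite nneseries_sum; last by move=> s k _; rewrite mule_ge0.
apply: eq_bigr => s _; rewrite muleC -ge0_nneseriesZl//.
by apply: eq_eseriesr => k _; rewrite muleC.
Qed.

(* The sums over the atoms are multiplied out one factor at a time, from the left. *)
Let expand m : forall ks (t := size ks) (a := nth None ks), mixture (t + m)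
  (fun A => \int[P]_w (\prod_(0 <= i < t) (wgt (a i) w * atm (a i) (A i) w) *
                       \prod_(t <= i < t + m) ssp w (A i))).
Proof.
elim: m => [|m ih] ks t a.
  have [q [s [q0 cs sn qE]]] := monomial_mixture ks.
  exists (fun u => if u == s then q else 0) => [u|A mA]; first by case: ifP.
  rewrite addn0 -big_filter (bigD1_seq s) ?filter_uniq ?uniq_pats//=; last first.
    by rewrite mem_filter cs /= (_ : t = size s) ?canon_pats.
  rewrite eqxx big1 ?adde0 => [|u /negPf->]; last by rewrite mul0e.
  by rewrite -qE//; apply: eq_integral => w _; rewrite [X in _ * X]big_geq ?mule1.
pose term k A := \int[P]_w (\prod_(0 <= i < t.+1)
    (wgt (nth None (rcons ks k) i) w * atm (nth None (rcons ks k) i) (A i) w) *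
   \prod_(t.+1 <= i < t.+1 + m) ssp w (A i)).
have mixk k : mixture (t + m.+1) (term k).
  by rewrite -addSnnS; have := ih (rcons ks k); rewrite /= size_rcons.
apply: mixture_eq (mixtureD (mixture_series (fun i => mixk (Some i))) (mixk None)).
move=> A mA; rewrite /term.
have termE k w : \prod_(0 <= i < t.+1)
      (wgt (nth None (rcons ks k) i) w * atm (nth None (rcons ks k) i) (A i) w) *
    \prod_(t.+1 <= i < t.+1 + m) ssp w (A i) =
    (\prod_(0 <= i < t) (wgt (a i) w * atm (a i) (A i) w) *
     \prod_(t.+1 <= i < t.+1 + m) ssp w (A i)) * (wgt k w * atm k (A t) w).
  rewrite big_nat_recr//= nth_rcons ltnn eqxx muleAC; congr (_ * _ * _).
  by apply: eq_big_nat => i /andP[_ it]; rewrite nth_rcons it.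
have mterms k : measurable_fun setT (fun w =>
    (\prod_(0 <= i < t) (wgt (a i) w * atm (a i) (A i) w) *
     \prod_(t.+1 <= i < t.+1 + m) ssp w (A i)) * (wgt k w * atm k (A t) w)).
  apply: emeasurable_funM; last exact: mterm.
  by apply: emeasurable_funM; apply: emeasurable_prod => i; [exact: mterm|exact: mssp].
have prod0 w : 0 <= \prod_(0 <= i < t) (wgt (a i) w * atm (a i) (A i) w) *
     \prod_(t.+1 <= i < t.+1 + m) ssp w (A i).
  by apply: mule_ge0; apply: prode_ge0 => i _ //; exact: mule_ge0.
under eq_eseriesr do under eq_integral do rewrite termE.
under [X in _ = _ + X]eq_integral do rewrite termE.
rewrite -integral_nneseries//; last by move=> k w _; rewrite mule_ge0// mule_ge0.
rewrite -ge0_integralD//; last 3 first.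
- by move=> w _; apply: nneseries_ge0 => k _ _; rewrite mule_ge0// mule_ge0.
- apply: ge0_emeasurable_sum => [k w _ _|k _]; first by rewrite mule_ge0// mule_ge0.
  exact: mterms.
- by move=> w _; rewrite mule_ge0// mule_ge0.
apply: eq_integral => w _.
rewrite ge0_nneseriesZl//; last by move=> k; rewrite mule_ge0.
rewrite -ge0_muleDr; last 2 first.
- by apply: nneseries_ge0 => k _ _; rewrite mule_ge0.
- by rewrite mule_ge0.
rewrite -/(ssp w (A t)) -addSnnS -muleA; congr (_ * _).
by rewrite big_ltn ?leq_addr// muleC.
Qed.

Lemma ssp_mixture n : exists2 q : seq nat -> \bar R,
  (forall s, 0 <= q s) & (forall A, (forall i, measurable (A i)) ->
    \int[P]_w \prod_(0 <= i < n) ssp_nu nu0 p eta w (A i) =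
    \sum_(s <- pats n | canon s)
      q s * P [set w | forall i, (i < n)%N -> A i (eta (nth 0%N s i) w)]).
Proof.
have [q q0 qE] := expand n [::].
exists q => // A mA; rewrite -qE//=; apply: eq_integral_ae.
apply: filterS ssp_nu_ae => w sspE.
by rewrite [X in X * _]big_geq// mul1e; apply: eq_bigr => i _.
Qed.

(** Allows unconstrained observations to be dropped from a mixed moment. *)
Lemma ssp_nuT_ae : {ae P, forall w, ssp_nu nu0 p eta w setT = 1}.
Proof.
apply: filterS p_ae => w [p0 p1]; rewrite /ssp_nu [nu0 _]probability_setT mule1.
under eq_eseriesr do rewrite indicT mule1.
rewrite addeC subeK// ge0_fin_numE ?(le_lt_trans p1)// ?ltry//.
by apply: nneseries_ge0 => k _ _; rewrite lee_fin.
Qed.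

End species_sampling.

(** * Canonical patterns and their one-step extensions *)

Lemma canon_le s i : canon s -> (i < size s)%N -> (nth 0%N s i <= i)%N.
Proof. by move=> /eqP <-; rewrite size_pat => ni; rewrite nth_pat// lab_le. Qed.

Lemma canon_lt s l : canon s -> l \in s -> (l < size s)%N.
Proof. by move=> /canon_pats /pats_lt; exact. Qed.

Lemma canon_fix s l : canon s -> l \in s -> nth 0%N s l = l.
Proof.
move=> cs /(nthP 0%N)[i si <-]; have si' := leq_ltn_trans (canon_le cs si) si.
have := lab_eq (nth 0%N s) i; rewrite -(@nth_pat _ (nth 0%N s) (size s))//.
by rewrite (eqP cs).
Qed.

Lemma index_canon s l : canon s -> l \in s -> index l s = l.
Proof.
move=> cs ls; apply/eqP; rewrite eqn_leq; apply/andP; split.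
  rewrite leqNgt; apply/negP => /(before_find 0%N)/=.
  by rewrite (canon_fix cs ls) eqxx.
have li : (index l s < size s)%N by rewrite index_mem.
by rewrite -[leqLHS](nth_index 0%N ls); exact: canon_le.
Qed.

(** A further observation either joins a block, whose label it takes, or opens a new block labelled
    by its own position. *)
Lemma canon_rcons s l :
  canon (rcons s l) = canon s && ((l \in s) || (l == size s)).
Proof.
rewrite /canon size_rcons patS (@eq_in_pat _ _ (nth 0%N s)); last first.
  by move=> i si; rewrite nth_rcons si.
rewrite /lab (_ : mkseq _ _ = s); last first.
  apply: (@eq_from_nth _ 0%N); rewrite size_mkseq// => i si.
  by rewrite nth_mkseq// nth_rcons si.
rewrite nth_rcons ltnn eqxx eqseq_rcons; have [cs|//] := eqVneq.
have cs' : canon s by apply/eqP.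
have [ls|ls] := boolP (l \in s); first by rewrite index_canon// eqxx.
by rewrite memNindex// eq_sym.
Qed.

(** The order [L] of the blocks is left open: [undup] keeps last occurrences, so appending an
    observation may reorder them. *)
Definition counts (s L : seq nat) : seq nat := [seq count_mem l s | l <- L].

(** * The predictive probabilities *)

Section exchangeable_partition.
Context {d} {T : measurableType d} {R : realType}.
Variables (P : probability T R) (v : nat -> T -> R) (pi : seq nat -> R).
Hypothesis v_pi : forall (n : nat) (Pt : {set {set 'I_n}}),
  finset.partition Pt [set: 'I_n] ->
  forall s : seq {set 'I_n}, perm_eq s (fintype.enum (mem Pt)) ->
  P (partition_event v Pt) = (pi (map (fun A : {set 'I_n} => #|A|) s))%:E.

(** The set partition behind [s] consists of the fibres of [nth 0 s]. Its blocks may be enumerated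
    in any order, in particular along [L]; this is the symmetry of the EPPF. *)
Lemma eppf_pat s L : canon s -> perm_eq L (undup s) ->
  P [set w | pat (size s) (fun i => v i.+1 w) = s] = (pi (counts s L))%:E.
Proof.
move=> cs Ls; set n := size s.
pose f (i : 'I_n) := nth 0%N s i.
pose Pt := preim_partition f ([set: 'I_n]%SET).
pose blk l : {set 'I_n} := [set i | f i == l]%SET.
have memL l : (l \in L) = (l \in s) by rewrite (perm_mem Ls) mem_undup.
have uL : uniq L by rewrite (perm_uniq Ls) undup_uniq.
have memPt A : (A \in Pt) = (A \in map blk L).
  apply/imsetP/mapP => [[i _ ->]|[l]].
    exists (f i); first by rewrite memL mem_nth.
    by apply/setP => k; rewrite !finset.inE eq_sym.
  rewrite memL => /(nthP 0%N)[i si <-] ->; exists (Ordinal si) => //.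
  by apply/setP => k; rewrite !finset.inE eq_sym.
rewrite (_ : mkset _ = partition_event v Pt); last first.
  rewrite /partition_event; apply/seteqP; split => w /=.
    rewrite -{1}(eqP cs) => /eq_pat vs i l.
    apply: (iff_trans (B := (f i == f l))).
      rewrite -vs//; split => /eqP; exact.
    split => [il|/existsP[A /andP[]]].
      apply/existsP; exists (blk (f i)); rewrite memPt map_f ?memL ?mem_nth//=.
      by rewrite !finset.inE eqxx eq_sym.
    by rewrite memPt => /mapP[k _ ->]; rewrite !finset.inE => /andP[/eqP-> /eqP->].
  move=> h; rewrite -[RHS](eqP cs); apply/eq_pat => i k ni nk.
  have hik := h (Ordinal ni) (Ordinal nk).
  apply/eqP/eqP => [/hik/existsP[A /andP[]]|ik].
    rewrite memPt => /mapP[l _ ->]; rewrite !finset.inE => /andP[/eqP il /eqP kl].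
    exact: etrans il (esym kl).
  apply/hik/existsP; exists (blk (nth 0%N s i)).
  by rewrite memPt map_f ?memL ?mem_nth//= !finset.inE/= /f/= -ik !eqxx.
rewrite (v_pi (preim_partitionP _ _) (s := map blk L)); last first.
  apply: uniq_perm; last by move=> A; rewrite mem_enum -memPt.
    rewrite map_inj_in_uniq// => l k; rewrite !memL => /(nthP 0%N)[i si <-] _.
    move=> /setP/(_ (Ordinal si)); rewrite !finset.inE /f/= eqxx.
    by move=> /esym/eqP.
  exact: enum_uniq.
congr (pi _)%:E; rewrite -map_comp; apply: eq_map => l /=.
rewrite cardsE cardE size_filter.
rewrite -[in RHS](mkseq_nth 0%N s) /mkseq -val_enum_ord -map_comp count_map.
by rewrite -enumT; apply: eq_count => i.
Qed.

End exchangeable_partition.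

Lemma undup_map_in (E E' : eqType) (f : E -> E') (s : seq E) :
  {in s &, injective f} -> undup (map f s) = map f (undup s).
Proof.
elim: s => //= a s ih finj; rewrite ih; last first.
  by move=> b c bs cs; apply: finj; rewrite inE ?bs ?cs orbT.
rewrite (_ : (f a \in map f s) = (a \in s)); first by case: ifP.
apply/mapP/idP => [[b bs fab]|as_]; last by exists a.
by rewrite (finj a b)// inE ?eqxx ?bs ?orbT.
Qed.

Section predictive.
Context {R : realType}.
Variables (pi : seq nat -> R) (nu0 : probability R R).

Definition pred_old (s : seq nat) (l : nat) : R :=
  pi (counts (rcons s l) (undup s)) / pi (counts s (undup s)).

Definition pred_new (s : seq nat) : R :=
  pi (rcons (counts s (undup s)) 1%N) / pi (counts s (undup s)).

(** Pattern and values are separate arguments so that [s] can be held fixed while [y] varies. Since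
    a label is the index of a member of its block, [y l] is the value of block [l]. *)
Definition predictive (s : seq nat) (y : nat -> R) (c : R) : R :=
  \sum_(l <- undup s) pred_old s l * (y l <= c)%R%:R + pred_new s * cdf_of nu0 c.

(** Distinct labels carry distinct values, so removing duplicates and counting occurrences both
    commute with passing from labels to values. *)
Lemma pred_rhsE (T : Type) (v : nat -> T -> R) J w (y := fun i => v i.+1 w) :
  pred_rhs pi nu0 v J.+1 w = predictive (pat J.+1 y) y (cfun (y J)).
Proof.
set s := pat J.+1 y; have cs : canon s := pat_canon y J.+1.
have ss : size s = J.+1 := size_pat y J.+1.
have yinj : {in s &, injective y}.
  move=> l k ls ks ylk.
  have labs i : i \in s -> lab y i = i.
    move=> si; rewrite -[RHS](canon_fix cs si) nth_pat// -ss.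
    exact: canon_lt cs si.
  by rewrite -(labs l ls) -(labs k ks); apply/eqP; rewrite labE ylk.
have obsE : [seq v i w | i <- iota 1 J.+1] = map y s.
  rewrite /s /pat /mkseq -map_comp -(addn0 1%N) iotaDl -map_comp.
  by apply: eq_map => i /=; rewrite lab_eq.
rewrite /pred_rhs obsE undup_map_in// size_map -map_comp.
have cntE :
    [seq (fun x => count_mem x (map y s)) (y l) | l <- undup s] = counts s (undup s).
  apply/eq_in_map => l; rewrite mem_undup => ls; rewrite count_map.
  by apply: eq_in_count => k ks /=; apply/eqP/eqP => [/yinj->//|->].
rewrite (_ : [seq _ | _ <- _] = counts s (undup s))//.
rewrite /predictive /=; congr (_ + _).
rewrite (big_nth 0%N) big_mkord; apply: eq_bigr => i _.
rewrite (nth_map 0%N)//; congr (_ / _ * _); congr (pi _).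
have si : (i < size (undup s))%N by [].
have sic : size (incr_nth (counts s (undup s)) i) = size (undup s).
  by rewrite size_incr_nth size_map si.
apply: (@eq_from_nth _ 0%N); rewrite sic ?size_map// => k sk.
rewrite nth_incr_nth !(nth_map 0%N)// -cats1 count_cat addnC; congr addn.
by rewrite [RHS]addn0 -(nth_uniq 0%N si sk) ?undup_uniq.
Qed.

End predictive.

(** * Measurability of [cfun] and of the distribution function *)

Lemma measurable_invr (R : realType) : measurable_fun setT (fun x : R => x^-1).
Proof.
rewrite -(setUv [set 0]); apply/measurable_funU => //.
  exact: measurableC.
split; first exact: measurable_fun_set1.
apply: open_continuous_measurable_fun => [|x].
  by apply: closed_openC; exact: closed_eq.
by rewrite inE/= => /eqP x0; exact: inv_continuous.
Qed.

Lemma measurable_cfun (R : realType) : measurable_fun setT (@cfun R).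
Proof.
apply: measurable_fun_ifT => //.
  by apply: measurable_fun_eqr => //; exact: measurable_cst.
apply: measurable_minr => //.
apply: measurable_funM => //.
apply: (measurableT_comp (@measurable_invr R)).
exact: measurable_funB.
Qed.

Lemma measurable_cdf (R : realType) (nu0 : probability R R) :
  measurable_fun setT (cdf_of nu0).
Proof.
apply: nondecreasing_measurable => // x y xy.
apply: fine_le; rewrite ?fin_num_measure//.
apply: le_measure; rewrite ?inE//.
by move=> z /=; rewrite !in_itv/= => /andP[-> /le_trans]; apply.
Qed.

(** * Events generated by finitely many variables, as preimages *)

Section coordinate_sigma_algebra.
Context {d} {T : measurableType d} {R : realType}.

(* [sigma_rv] is used with indices 1..n, [seqn n] with indices 0..n-1. *)
Lemma sigma_rv_coord (u : nat -> T -> R) n i : (i < n)%N ->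
  measurable_fun setT (u i.+1 : g_sigma_algebraType [set S | exists k (D : set R),
    [set k | (1 <= k <= n)%N] k /\ measurable D /\ S = u k @^-1` D] -> R).
Proof.
move=> ni _ D mD; rewrite setTI; apply: sub_sigma_algebra.
by exists i.+1, D; split.
Qed.

Lemma sigma_rv_preimage (u : nat -> T -> R) n (G : set (seqn n)) :
  measurable G ->
  sigma_rv u [set k | (1 <= k <= n)%N] [set w | G (fun i => u i.+1 w)].
Proof.
move=> mG.
have := @measurable_seqn _ (g_sigma_algebraType [set S | exists k (D : set R),
    [set k | (1 <= k <= n)%N] k /\ measurable D /\ S = u k @^-1` D]) R
  (fun i => u i.+1) n (@sigma_rv_coord u n) measurableT G mG.
by rewrite setTI.
Qed.

(** Preimages of measurable sets form a sigma-algebra, and it contains the generators. *)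
Lemma sigma_rvP (u : nat -> T -> R) n (B : set T) :
  sigma_rv u [set k | (1 <= k <= n)%N] B ->
  exists2 G : set (seqn n), measurable G & B = [set w | G (fun i => u i.+1 w)].
Proof.
suff h : sigma_rv u [set k | (1 <= k <= n)%N] `<=` [set B |
    exists2 G : set (seqn n), measurable G & B = [set w | G (fun i => u i.+1 w)]].
  exact: h.
rewrite /sigma_rv; apply: smallest_sub.
  split.
  - by exists set0 => //; apply/seteqP; split.
  - move=> _ [G mG ->]; exists (~` G); first exact: measurableC.
    by rewrite setTD.
  - move=> F FG; have h k := cid2 (FG k); exists (\bigcup_k s2val (h k)).
      by apply: bigcupT_measurable => k; exact: (s2valP (h k)).
    by apply: eq_bigcupr => k _; exact: (s2valP' (h k)).
move=> _ [[|i] [D [ni [mD ->]]]]; first by [].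
exists ((fun y : seqn n => y i) @^-1` D).
  by rewrite -[X in measurable X]setTI; exact: measurable_coord.
by [].
Qed.

End coordinate_sigma_algebra.

(** * Stick breaking *)

Section stick_breaking.
Context {R : realType}.
Implicit Types (y : nat -> R).

Definition stick_seq y : nat -> R := fun i => y i * \prod_(0 <= k < i) (1 - y k).

(* Recovers [y] from its stick-breaking weights if no [y k] equals 1. *)
Definition unstick_seq y : nat -> R := fun i => y i / (1 - \sum_(0 <= k < i) y k).

Lemma stickE (T : Type) (v : nat -> T -> R) i w :
  stick v i.+1 w = stick_seq (fun k => v k.+1 w) i.
Proof. by rewrite /stick /stick_seq big_add1. Qed.

Lemma sum_stick_seq y n :
  1 - \sum_(0 <= k < n) stick_seq y k = \prod_(0 <= k < n) (1 - y k).
Proof.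
elim: n => [|n ih]; first by rewrite !big_geq// subr0.
by rewrite !big_nat_recr//= opprD addrA ih /stick_seq mulrC mulrBr mulr1.
Qed.

Lemma stick_seqK y i : (forall k, y k != 1) -> unstick_seq (stick_seq y) i = y i.
Proof.
move=> y1; rewrite /unstick_seq sum_stick_seq /stick_seq mulfK//.
by rewrite prodf_seq_neq0; apply/allP => k _; rewrite /= subr_eq0 eq_sym.
Qed.

(** After division by the positive length of stick left before step [i], the comparison reads
    [y i.+1 * (1 - y i) <= y i]; the minimum with 1 in [cfun] is harmless because [y i.+1 <= 1]. *)
Lemma le_stick_seq y i : (forall k, 0 <= y k <= 1) -> (forall k, y k != 1) ->
  (stick_seq y i.+1 <= stick_seq y i) = (y i.+1 <= cfun (y i)).
Proof.
move=> y01 y1; have lt1 k : 0 < 1 - y k.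
  by rewrite subr_gt0 lt_neqAle y1; case/andP: (y01 k).
rewrite /stick_seq big_nat_recr//= mulrCA [leRHS]mulrC ler_pM2l; last first.
  by apply: prodr_gt0 => k _.
rewrite /cfun (negPf (y1 i)) le_min ler_pdivlMr//.
by case/andP: (y01 i.+1) => _ ->.
Qed.

Lemma measurable_stick_seq n :
  measurable_fun setT (stick_seq : seqn n -> seqn n).
Proof.
apply: (@measurable_seqn _ (seqn n) R (fun i y => stick_seq y i) n) => i ni.
apply: measurable_funM; first exact: measurable_coord.
apply: measurable_prod => k; rewrite mem_index_iota => /andP[_ ki].
by apply: measurable_funB => //; apply: measurable_coord; exact: ltn_trans ki ni.
Qed.

Lemma measurable_unstick_seq n :
  measurable_fun setT (unstick_seq : seqn n -> seqn n).
Proof.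
apply: (@measurable_seqn _ (seqn n) R (fun i y => unstick_seq y i) n) => i ni.
apply: measurable_funM; first exact: measurable_coord.
apply: (measurableT_comp (@measurable_invr R)); apply: measurable_funB => //.
(* The guard makes the summand measurable on [seqn n] for every [k], including those outside the
   range of the sum. *)
rewrite (_ : (fun y => _) = (fun y : seqn n => \sum_(k <- index_iota 0 i)
  (if (k < n)%N then y k else 0))); last first.
  apply/funext => y; apply: eq_big_nat => k /andP[_ ki].
  by rewrite (ltn_trans ki ni).
apply: measurable_sum => k; have [kn|_] := ltnP k n; last exact: measurable_cst.
exact: measurable_coord.
Qed.

End stick_breaking.

(** The sets that do not separate [y] from [y'] form a sigma-algebra containing the rectangles. *)
Lemma seqn_local (R : realType) n (G : set (seqn n)) (y y' : nat -> R) :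
  measurable G -> (forall i, (i < n)%N -> y i = y' i) -> G y -> G y'.
Proof.
move=> mG yy'.
suff /(_ _ mG) h : <<s @rects R n >> `<=` [set G | G y <-> G y'] by move/h.
apply: smallest_sub; last first.
  by move=> _ [A mA <-] /=; split => yA i ni; have := yA i ni; rewrite yy'.
split => //.
- by move=> B [yB y'B]; split => -[_ nB]; split => // ?; apply: nB; [exact: y'B|exact: yB].
- by move=> F FG; split => -[k _ /FG]; exists k.
Qed.

Lemma seqn_widen (R : realType) n m (G : set (nat -> R)) : (n <= m)%N ->
  measurable (G : set (seqn n)) -> measurable (G : set (seqn m)).
Proof.
move=> nm mG; rewrite -[X in measurable X]setTI.
apply: (@measurable_seqn _ (seqn m) R (fun i (y : seqn m) => y i) n) => // i ni.
exact: measurable_coord (leq_trans ni nm).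
Qed.

(** * The prediction rule *)

Section predictive_rule.
Context {d} {T : measurableType d} {R : realType}.
Variables (P : probability T R) (nu0 : probability R R) (p eta : nat -> T -> R).
Variables (v : nat -> T -> R) (pi : seq nat -> R).
Hypothesis nu0_01 : nu0 `[0, 1]%classic = 1%E.
Hypothesis nu0_diffuse : forall x : R, nu0 [set x] = 0%E.
Hypothesis p_meas : forall k, measurable_fun setT (p k).
Hypothesis eta_meas : forall k, measurable_fun setT (eta k).
Hypothesis p_ae : {ae P, forall w, (forall k, 0 <= p k w) /\
                                   (\sum_(0 <= k <oo) (p k w)%:E <= 1)%E}.
Hypothesis p_eta_indep : forall A B, sigma_rv p setT A -> sigma_rv eta setT B ->
                                     P (A `&` B) = (P A * P B)%E.
Hypothesis eta_iid : forall (n : nat) (C : nat -> set R),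
  (forall k, measurable (C k)) ->
  P [set w | forall k, (k < n)%N -> C k (eta k w)] = (\prod_(k < n) nu0 (C k))%E.
Hypothesis v_meas : forall i, (1 <= i)%N -> measurable_fun setT (v i).
Hypothesis v_ciid : forall (n : nat) (A : nat -> set R),
  (forall i, measurable (A i)) ->
  forall B, sigma_rm (ssp_nu nu0 p eta) B ->
  P (B `&` [set w | forall i, (1 <= i <= n)%N -> A i (v i w)]) =
  (\int[P]_(w in B) \prod_(1 <= i < n.+1) ssp_nu nu0 p eta w (A i))%E.
Hypothesis v_pi : forall (n : nat) (Pt : {set {set 'I_n}}),
  finset.partition Pt [set: 'I_n] ->
  forall s : seq {set 'I_n}, perm_eq s (fintype.enum (mem Pt)) ->
  P (partition_event v Pt) = (pi (map (fun A : {set 'I_n} => #|A|) s))%:E.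
Local Open Scope ereal_scope.

Let x (i : nat) : T -> R := v i.+1.

Let mx i : measurable_fun setT (x i). Proof. exact: v_meas. Qed.

Let Q s := P [set w | pat (size s) (x^~ w) = s].

Let etas (s : seq nat) (w : T) : nat -> R := fun i => eta (nth 0%N s i) w.

Lemma v_rect n A : (forall i, measurable (A i)) ->
  P [set w | forall i, (i < n)%N -> A i (x i w)] =
  \int[P]_w \prod_(0 <= i < n) ssp_nu nu0 p eta w (A i).
Proof.
move=> mA; have sT : sigma_rm (ssp_nu nu0 p eta) setT.
  exact: (@measurableT _ (g_sigma_algebraType _)).
have := @v_ciid n (fun i => A i.-1) (fun i => mA i.-1) _ sT.
rewrite setTI => vA; transitivity (P [set w | forall i, (1 <= i <= n)%N -> A i.-1 (v i w)]).
  congr (P _); apply/seteqP; split => w wA i.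
    by case: i => // i /andP[_ ni]; exact: wA.
  by move=> ni; exact: (wA i.+1).
by rewrite vA; apply: eq_integral => w _; rewrite big_add1.
Qed.

Lemma v_mixture n : exists2 q : seq nat -> \bar R,
  (forall s, 0 <= q s) & (forall A, (forall i, measurable (A i)) ->
    P [set w | forall i, (i < n)%N -> A i (x i w)] =
    \sum_(s <- pats n | canon s)
      q s * P [set w | forall i, (i < n)%N -> A i (eta (nth 0%N s i) w)]).
Proof.
have [q q0 qE] := ssp_mixture p_meas eta_meas p_ae p_eta_indep eta_iid n.
by exists q => // A mA; rewrite v_rect// qE.
Qed.

Lemma pattern_law n s (G : set (seqn n)) : canon s -> size s = n -> measurable G ->
  P [set w | pat n (x^~ w) = s /\ G (x^~ w)] = Q s * P [set w | G (etas s w)].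
Proof.
move=> cs sn mG; have [q q0 qE] := v_mixture n.
have key := mixture_pat nu0_diffuse eta_meas eta_iid (fun i _ => mx i) q0 qE cs sn.
(* Taking the whole space for [G] reveals the unknown coefficient [q s] as [Q s]. *)
rewrite key//; congr (_ * _); have := key setT measurableT.
rewrite [X in _ * X](probability_setT P) mule1 => <-; congr (P _); rewrite -sn.
by apply/seteqP; split => w /=; [case|].
Qed.

Lemma law_mixture n (G : set (seqn n)) : measurable G ->
  P [set w | G (x^~ w)] = \sum_(s <- pats n | canon s) Q s * P [set w | G (etas s w)].
Proof.
move=> mG; have [q q0 qE] := v_mixture n.
rewrite (mixture_law eta_meas (fun i _ => mx i) q0 qE mG).
rewrite big_seq_cond [RHS]big_seq_cond; apply: eq_bigr => s /andP[/size_pats sn cs].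
rewrite -pattern_law//.
exact/esym/(mixture_pat nu0_diffuse eta_meas eta_iid (fun i _ => mx i) q0 qE cs sn).
Qed.

Let mQ s : measurable [set w | pat (size s) (x^~ w) = s].
Proof. by apply: measurable_pat. Qed.

Let Q_fin s : Q s = (fine (Q s))%:E.
Proof. by rewrite fineK// fin_num_measure//; exact: mQ. Qed.

Lemma metas n s : measurable_fun setT (etas s : T -> seqn n).
Proof. by apply: (@measurable_seqn _ T R (fun i => eta (nth 0%N s i))). Qed.

(** The pattern events form a finite partition of the space; on each of them [pattern_law] exchanges
    the observations for atoms, up to the factor [Q s]. *)
Lemma mixture_integral n (G : set (seqn n)) (h : seqn n -> \bar R) :
  measurable G -> measurable_fun setT h -> (forall y, 0 <= h y) ->
  \int[P]_(w in [set w | G (x^~ w)]) h (x^~ w) =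
  \sum_(s <- pats n | canon s) Q s * \int[P]_(w in [set w | G (etas s w)]) h (etas s w).
Proof.
move=> mG mh h0.
have mhG : measurable_fun setT (h \_ G).
  by apply/(measurable_restrictT _ mG); exact: measurable_funTS.
have hG0 y : 0 <= (h \_ G) y by rewrite patchE; case: ifP.
have mX : measurable_fun setT (fun w => x^~ w : seqn n) by exact: measurable_seqn.
rewrite integral_mkcond.
rewrite (_ : _ \_ _ = (fun w => (h \_ G) (x^~ w))); last first.
  by apply/funext => w; rewrite /patch.
have -> : [set: T] = \big[setU/set0]_(s <- pats n) [set w | pat n (x^~ w) = s].
  apply/seteqP; split => // w _; rewrite -bigcup_seq/=.
  by exists (pat n (x^~ w)) => //=; exact: mem_pat.
rewrite ge0_integral_bigsetU//; last 4 first.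
- by move=> s; exact: measurable_pat.
- exact: uniq_pats.
- by move=> s t _ _ [w [/= -> ->]].
- by apply: measurable_funTS; exact: (measurableT_comp mhG mX).
rewrite (bigID canon)/= [X in _ + X]big1 ?adde0; last first.
  move=> s ncs; rewrite (_ : mkset _ = set0) ?integral_set0//.
  by apply/seteqP; split => // w /= ws; move: ncs; rewrite -ws pat_canon.
rewrite big_seq_cond [RHS]big_seq_cond; apply: eq_bigr => s /andP[/size_pats sn cs].
rewrite [in RHS]integral_mkcond.
rewrite (_ : (fun w => h (etas s w)) \_ _ = (fun w => (h \_ G) (etas s w))); last first.
  by apply/funext => w; rewrite /patch.
rewrite Q_fin; apply: (@integral_transfer _ _ _ _ (seqn n) P) => //.
- exact: measurable_pat.
- exact: metas.
- exact: fine_ge0.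
- by move=> H mH; rewrite -Q_fin -pattern_law.
Qed.

Let nu0_itv : {ae nu0, forall z, (0 <= z <= 1)%R}.
Proof.
exists (~` `[0%R, 1%R]%classic); split; first exact: measurableC.
  by rewrite probability_setC// nu0_01 subee.
by move=> z /= nz /=; rewrite in_itv.
Qed.

(** [nu0] is carried by the unit interval, so the lower endpoint 0 in [cdf_of] cuts off a null
    set. *)
Lemma cdfE c : nu0 [set z | (z <= c)%R] = (cdf_of nu0 c)%:E.
Proof.
rewrite /cdf_of fineK ?fin_num_measure//.
have -> : [set z | (z <= c)%R] = `]-oo, c]%classic by rewrite set_itvE.
apply: eq_measure_ae => //; apply: filterS nu0_itv => z /andP[z0 _].
by rewrite /= !in_itv/= z0.
Qed.

Lemma measurable_predictive s J n : (forall l, l \in s -> (l < n)%N) -> (J < n)%N ->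
  measurable_fun setT (fun y : seqn n => predictive pi nu0 s y (cfun (y J))).
Proof.
move=> sn Jn; have mc : measurable_fun setT (fun y : seqn n => cfun (y J : R)).
  exact: (measurableT_comp (@measurable_cfun R) (measurable_coord Jn)).
apply: measurable_funD; last first.
  apply: measurable_funM => //.
  exact: (measurableT_comp (measurable_cdf nu0) mc).
rewrite (_ : (fun y : seqn n => _) = (fun y : seqn n => \sum_(l <- undup s)
  (if l \in s then pred_old pi s l * (y l <= cfun (y J))%R%:R else 0))%R); last first.
  apply/funext => y; rewrite big_seq [RHS]big_seq; apply: eq_bigr => l.
  by rewrite mem_undup => ->.
apply: measurable_sum => l; have [ls|_] := boolP (l \in s); last exact: measurable_cst.
apply: measurable_funM => //.
rewrite (_ : (fun y => _) = (fun y : seqn n => if (y l <= cfun (y J))%R then 1 else 0)%R).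
  apply: measurable_fun_ifT => //.
  by apply: measurable_fun_ler => //; apply: measurable_coord; exact: sn.
by apply/funext => y; case: ifP.
Qed.

(** The pattern varies with [y]; summing over all candidates against their indicators reduces the
    claim to a fixed pattern. *)
Lemma measurable_pred J : measurable_fun setT
  (fun y : seqn J.+1 => predictive pi nu0 (pat J.+1 y) y (cfun (y J))).
Proof.
rewrite (_ : (fun y => _) = (fun y : seqn J.+1 => \sum_(s <- pats J.+1)
  (if s \in pats J.+1 then (pat J.+1 (fun i => y i : R) == s)%:R *
   predictive pi nu0 s y (cfun (y J)) else 0))%R); last first.
  apply/funext => y; rewrite (bigD1_seq (pat J.+1 (fun i => y i : R))) ?uniq_pats ?mem_pat//=.
  rewrite eqxx mul1r big1 ?addr0// => s /negPf; rewrite eq_sym => ->.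
  by rewrite mul0r if_same.
apply: measurable_sum => s; have [sJ|_] := boolP (s \in _); last exact: measurable_cst.
apply: measurable_funM; last by apply: measurable_predictive => // l; exact: pats_lt.
rewrite (_ : (fun y => _) = \1_[set y : seqn J.+1 | pat J.+1 (fun i => y i : R) = s]).
  apply/measurable_indic.
  exact: (@measurable_pat _ (seqn J.+1) R (fun i (y : seqn J.+1) => y i) J.+1 s
    (fun i ni => measurable_coord ni)).
apply/funext => y; rewrite indicE; congr (nat_of_bool _)%:R.
by apply/eqP/idP; rewrite inE.
Qed.

Let Q_pi s L : canon s -> perm_eq L (undup s) -> Q s = (pi (counts s L))%:E.
Proof. by move=> cs Ls; exact: (eppf_pat v_pi cs Ls). Qed.

Let pi_ge0 s L : canon s -> perm_eq L (undup s) -> (0 <= pi (counts s L))%R.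
Proof. by move=> cs Ls; rewrite -lee_fin -(Q_pi cs Ls) measure_ge0. Qed.

(** The blocks stay in the order of [undup s], as the prediction rule requires, although
    [undup (rcons s l)] would put block [l] last. *)
Let Q_old s l : canon s -> l \in s ->
  Q (rcons s l) = (pi (counts (rcons s l) (undup s)))%:E.
Proof.
move=> cs ls; apply: Q_pi; first by rewrite canon_rcons cs ls.
apply: uniq_perm; rewrite ?undup_uniq// => k.
by rewrite !mem_undup mem_rcons inE; case: eqVneq => // ->.
Qed.

Let Q_new s : canon s ->
  Q (rcons s (size s)) = (pi (rcons (counts s (undup s)) 1%N))%:E.
Proof.
move=> cs; have ns : size s \notin s.
  by apply/negP => /(canon_lt cs); rewrite ltnn.
rewrite (@Q_pi _ (rcons (undup s) (size s))); last 2 first.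
- by rewrite canon_rcons cs eqxx orbT.
- apply: uniq_perm; rewrite ?undup_uniq ?rcons_uniq ?mem_undup ?ns ?undup_uniq// => k.
  by rewrite mem_undup !mem_rcons !inE mem_undup.
congr (pi _)%:E; rewrite /counts map_rcons; congr rcons.
  apply/eq_in_map => l; rewrite mem_undup => ls.
  rewrite -cats1 count_cat/= addn0 (_ : (size s == l) = false) ?addn0//.
  by apply/eqP => sl; move: ns; rewrite sl ls.
by rewrite -cats1 count_cat/= eqxx (count_memPn ns).
Qed.

Let Q_rcons s l : Q s = 0 -> Q (rcons s l) = 0.
Proof.
move=> Qs; apply/eqP; rewrite eq_le measure_ge0 andbT -Qs.
apply: le_measure; rewrite ?inE; try exact: mQ.
by move=> w /=; rewrite size_rcons patS => /rcons_inj[].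
Qed.

(** If the denominator vanishes, the pattern [s] has probability zero and so do its extensions; the
    default value of the quotient is then harmless. *)
Let Q_pred_old s l : canon s -> l \in s ->
  Q s * (pred_old pi s l)%:E = Q (rcons s l).
Proof.
move=> cs ls; have Qs := Q_pi cs (perm_refl _).
rewrite Qs Q_old// -EFinM /pred_old; congr (_%:E).
have [pi0|pi0] := eqVneq (pi (counts s (undup s))) 0%R; last by rewrite mulrC divfK.
have := @Q_rcons s l; rewrite Qs pi0 => /(_ erefl); rewrite Q_old// => -[->].
by rewrite !mul0r.
Qed.

Let Q_pred_new s : canon s ->
  Q s * (pred_new pi s)%:E = Q (rcons s (size s)).
Proof.
move=> cs; have Qs := Q_pi cs (perm_refl _).
rewrite Qs Q_new// -EFinM /pred_new; congr (_%:E).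
have [pi0|pi0] := eqVneq (pi (counts s (undup s))) 0%R; last by rewrite mulrC divfK.
have := @Q_rcons s (size s); rewrite Qs pi0 => /(_ erefl); rewrite Q_new// => -[->].
by rewrite !mul0r.
Qed.

Let pred_old_ge0 s l : canon s -> l \in s -> (0 <= pred_old pi s l)%R.
Proof.
move=> cs ls; rewrite /pred_old divr_ge0 ?(pi_ge0 cs)//.
by rewrite -lee_fin -Q_old// measure_ge0.
Qed.

Let pred_new_ge0 s : canon s -> (0 <= pred_new pi s)%R.
Proof.
move=> cs; rewrite /pred_new divr_ge0 ?(pi_ge0 cs)//.
by rewrite -lee_fin -Q_new// measure_ge0.
Qed.

Lemma cdf_ge0 c : (0 <= cdf_of nu0 c)%R.
Proof. exact: fine_ge0. Qed.

Lemma predictive_ge0 s y c : canon s -> (0 <= predictive pi nu0 s y c)%R.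
Proof.
move=> cs; apply: addr_ge0; last by rewrite mulr_ge0 ?pred_new_ge0 ?cdf_ge0.
rewrite big_seq; apply: sumr_ge0 => l; rewrite mem_undup => ls.
by rewrite mulr_ge0 ?ler0n ?pred_old_ge0.
Qed.

Let le_cfun J s l (w : T) := (eta l w <= cfun (etas s w J))%R.

Let metaJ J s : measurable_fun setT (fun w => cfun (etas s w J)).
Proof. exact: (measurableT_comp (@measurable_cfun R) (eta_meas _)). Qed.

Let mG_etas n s (G : set (seqn n)) : measurable G -> measurable [set w | G (etas s w)].
Proof.
by move=> mG; rewrite -[X in measurable X]setTI; exact: (@metas n s measurableT G mG).
Qed.

Let mle_cfun J s l : measurable [set w | le_cfun J s l w].
Proof.
have mle := measurable_fun_ler (eta_meas l) (metaJ J s).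
by rewrite -[X in measurable X]setTI; exact: (mle measurableT (set1 true)).
Qed.

(** All labels in [s] lie below [J.+1], so the atom with this index is fresh and can be integrated
    out. *)
Let new_atom J s (G : set (seqn J.+1)) : canon s -> size s = J.+1 -> measurable G ->
  P [set w | le_cfun J s J.+1 w /\ G (etas s w)] =
  \int[P]_(w in [set w | G (etas s w)]) (cdf_of nu0 (cfun (etas s w J)))%:E.
Proof.
move=> cs sJ mG; have snth i : (i < J.+1)%N -> (nth 0%N s i < J.+1)%N.
  by move=> iJ; rewrite -sJ; apply: canon_lt => //; rewrite mem_nth// sJ.
have mcoord i : (i < J.+1)%N ->
    measurable_fun setT (fun z : seqn J.+1 * R => z.1 (nth 0%N s i) : R).
  by move=> iJ; exact: (measurableT_comp (measurable_coord (snth _ iJ)) measurable_fst).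
pose H1 : set (seqn J.+1 * R) := [set z | (z.2 <= cfun (z.1 (nth 0%N s J)))%R].
pose H2 : set (seqn J.+1 * R) := [set z | G (fun i => z.1 (nth 0%N s i))].
have mH1 : measurable H1.
  have mle := measurable_fun_ler (@measurable_snd _ _ (seqn J.+1) R)
    (measurableT_comp (@measurable_cfun R) (mcoord J (leqnn _))).
  by rewrite -[X in measurable X]setTI; exact: (mle measurableT (set1 true)).
have mH2 : measurable H2.
  rewrite -[X in measurable X]setTI.
  exact: (@measurable_seqn _ _ R (fun i (z : seqn J.+1 * R) => z.1 (nth 0%N s i)) J.+1).
have := atoms_fubini eta_meas eta_iid (measurableI _ _ mH1 mH2).
rewrite /= => ->; rewrite [RHS]integral_mkcond; apply: eq_integral => w _.
rewrite patchE; case: ifPn => [|nGw].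
  rewrite inE /= => Gw; rewrite -cdfE; congr (nu0 _); apply/seteqP.
  by split => z; rewrite /xsection/= inE /H1 /H2 /=; [case|].
transitivity (nu0 set0); last exact: measure0.
congr (nu0 _); apply/seteqP; split => // z.
rewrite /xsection/= inE => -[_ Gw].
by move: nGw; rewrite notin_setE; apply.
Qed.

(** Expresses the integrated prediction rule through the very events that the extensions of [s]
    produce in the mixture for [J.+2] observations. *)
Let predictive_integral J s (G : set (seqn J.+1)) :
  canon s -> size s = J.+1 -> measurable G ->
  \int[P]_(w in [set w | G (etas s w)])
    (predictive pi nu0 (pat J.+1 (etas s w)) (etas s w) (cfun (etas s w J)))%:E =
  \sum_(l <- undup s) (pred_old pi s l)%:E * P [set w | le_cfun J s l w /\ G (etas s w)] +
  (pred_new pi s)%:E * P [set w | le_cfun J s J.+1 w /\ G (etas s w)].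
Proof.
move=> cs sJ mG; have mGs := @mG_etas _ s _ mG.
have a0 l : l \in undup s -> (0 <= pred_old pi s l)%R.
  by rewrite mem_undup; exact: pred_old_ge0.
have mind l : measurable_fun [set w | G (etas s w)]
    (fun w => ((le_cfun J s l w)%:R : R)).
  apply: measurable_funTS.
  rewrite (_ : (fun w => _) = \1_[set w | le_cfun J s l w]).
    by apply/measurable_indic; exact: mle_cfun.
  by apply/funext => w; rewrite indicE mem_setE.
transitivity (\int[P]_(w in [set w | G (etas s w)])
   (\sum_(l <- undup s) (pred_old pi s l * (le_cfun J s l w)%:R)%R%:E +
    (pred_new pi s)%:E * (cdf_of nu0 (cfun (etas s w J)))%:E)).
  (* Almost surely the atoms read along [s] have pattern [s], and a label is its own label, so
     [etas s w l] is [eta l]. *)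
  rewrite integral_mkcond [RHS]integral_mkcond; apply: eq_integral_ae.
  apply: filterS (atoms_pat nu0_diffuse eta_meas eta_iid cs) => w.
  rewrite sJ => ws; rewrite /patch; case: ifP => // _.
  rewrite /etas ws /predictive EFinD EFinM sumEFin; congr (_%:E + _).
  rewrite big_seq [RHS]big_seq; apply: eq_bigr => l.
  by rewrite mem_undup => /(canon_fix cs) {1}->.
rewrite ge0_integralD//; last 4 first.
- move=> w _; rewrite big_seq; apply: sume_ge0 => l ls.
  by rewrite lee_fin mulr_ge0 ?a0 ?ler0n.
- by apply: emeasurable_sum => l; apply/measurable_EFinP; exact: measurable_funM.
- by move=> w _; rewrite mule_ge0// lee_fin ?pred_new_ge0 ?cdf_ge0.
- apply: emeasurable_funM => //; apply/measurable_EFinP; apply: measurable_funTS.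
  exact: (measurableT_comp (measurable_cdf nu0) (metaJ J s)).
rewrite ge0_integralZl_EFin ?pred_new_ge0//; last 2 first.
- by move=> w _; rewrite lee_fin cdf_ge0.
- apply/measurable_EFinP; apply: measurable_funTS.
  exact: (measurableT_comp (measurable_cdf nu0) (metaJ J s)).
rewrite new_atom//; congr (_ + _).
rewrite (eq_integral (fun w => \sum_(l <- undup s)
  (if l \in undup s then pred_old pi s l * (le_cfun J s l w)%:R else 0)%R%:E)); last first.
  by move=> w _; rewrite big_seq [RHS]big_seq; apply: eq_bigr => l ->.
rewrite ge0_integral_sum//; last 2 first.
- move=> l; have [ls|_] := boolP (l \in undup s); last exact: measurable_cst.
  by apply/measurable_EFinP; exact: measurable_funM.
- by move=> l w _; case: ifP => // ls; rewrite lee_fin mulr_ge0 ?a0 ?ler0n.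
rewrite big_seq [RHS]big_seq; apply: eq_bigr => l ls; rewrite ls.
under eq_integral do rewrite EFinM.
rewrite ge0_integralZl_EFin ?a0//; last exact/measurable_EFinP.
congr (_ * _); rewrite -[RHS](@integral_indic _ _ _ P [set w | G (etas s w)])//;
  last exact: mle_cfun.
by apply: eq_integral => w _; rewrite indicE mem_setE.
Qed.

Lemma predictive_rule J (G : set (seqn J.+1)) : measurable G ->
  P [set w | (v J.+2 w <= cfun (v J.+1 w))%R /\ G (x^~ w)] =
  \int[P]_(w in [set w | G (x^~ w)]) (pred_rhs pi nu0 v J.+1 w)%:E.
Proof.
move=> mG.
pose H1 : set (@seqn R J.+2) := [set y : nat -> R | (y J.+1 <= cfun (y J))%R].
have mH1 : measurable H1.
  have mJ : measurable_fun setT (fun y : seqn J.+2 => y J : R).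
    exact: measurable_coord.
  have mle := measurable_fun_ler (@measurable_coord R J.+2 J.+1 (leqnn _))
    (measurableT_comp (@measurable_cfun R) mJ).
  by rewrite -[X in measurable X]setTI; exact: (mle measurableT (set1 true)).
have mH : measurable (H1 `&` G : set (seqn J.+2)).
  by apply: measurableI => //; exact: seqn_widen mG.
transitivity (P [set w | (H1 `&` G) (x^~ w)]); first by [].
rewrite (law_mixture mH).
under [RHS]eq_integral do rewrite pred_rhsE.
rewrite (@mixture_integral _ G (fun y =>
  (predictive pi nu0 (pat J.+1 y) y (cfun (y J)))%:E))//; last 2 first.
- by apply/measurable_EFinP; exact: measurable_pred.
- by move=> y; rewrite lee_fin predictive_ge0// pat_canon.
(* Grouping the longer patterns by their first [J.+1] labels reduces the claim to a single [s]. *)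
have -> : pats J.+2 = [seq rcons t k | t <- pats J.+1, k <- iota 0 J.+2] by [].
rewrite big_mkcond big_allpairs_dep [RHS]big_mkcond.
rewrite big_seq [RHS]big_seq; apply: eq_bigr => s spats.
have sJ := size_pats spats; case: ifPn => [cs|ncs]; last first.
  by rewrite big1// => l _; rewrite canon_rcons (negPf ncs).
rewrite predictive_integral// ge0_muleDr; last 2 first.
- rewrite big_seq; apply: sume_ge0 => l; rewrite mem_undup => ls.
  by rewrite mule_ge0// lee_fin pred_old_ge0.
- by rewrite mule_ge0// lee_fin pred_new_ge0.
(* [G] sees only the first [J.+1] entries, which the appended label leaves unchanged. *)
have HE l : (if canon (rcons s l) then
      Q (rcons s l) * P [set w | (H1 `&` G) (etas (rcons s l) w)] else 0) =
    (if canon (rcons s l) then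
      Q (rcons s l) * P [set w | le_cfun J s l w /\ G (etas s w)] else 0).
  case: ifP => // _; congr (_ * P _).
  have local w i : (i < J.+1)%N -> etas (rcons s l) w i = etas s w i.
    by move=> iJ; rewrite /etas nth_rcons sJ iJ.
  have HJ w : H1 (etas (rcons s l) w) <-> le_cfun J s l w.
    by rewrite /H1/= (local w J)// /etas nth_rcons sJ ltnn eqxx.
  apply/seteqP; split => w [/HJ Hw Gw]; split => //.
    by apply: (seqn_local mG) Gw => i /local.
  by apply: (seqn_local mG) Gw => i /local.
under eq_bigr do rewrite HE.
rewrite -big_mkcond -big_filter.
rewrite (perm_big (rcons (undup s) J.+1)); last first.
  apply: uniq_perm.
  - by rewrite filter_uniq// iota_uniq.
  - rewrite rcons_uniq undup_uniq mem_undup andbT.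
    by apply/negP => /(canon_lt cs); rewrite sJ ltnn.
  - move=> l; rewrite mem_filter mem_iota/= add0n canon_rcons cs sJ/=.
    rewrite mem_rcons inE mem_undup orbC.
    have [->|_] := eqVneq l J.+1; first by rewrite ltnSn.
    by apply/andb_idr => /(canon_lt cs); rewrite sJ => /ltnW.
have := Q_pred_new cs; rewrite sJ big_rcons/= => <-.
rewrite -muleA; congr (_ + _).
rewrite [LHS]big_seq [in RHS]big_seq ge0_sume_distrr => [|l]; last first.
  by rewrite mem_undup => ls; rewrite mule_ge0// lee_fin pred_old_ge0.
apply: eq_bigr => l; rewrite mem_undup => ls.
by rewrite muleA Q_pred_old.
Qed.

Let eta_law k (C : set R) : measurable C -> P (eta k @^-1` C) = nu0 C.
Proof.
move=> mC; have -> : eta k @^-1` C =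
    [set w | forall i, (i < k.+1)%N -> (if i == k then C else setT) (eta i w)].
  apply/seteqP; split => w /=; first by move=> Ck i _; case: eqVneq => // ->.
  by move=> /(_ k (ltnSn k)); rewrite eqxx.
rewrite (@eta_iid k.+1 (fun i => if i == k then C else setT)) => [|i]; last by case: ifP.
rewrite big_ord_recr/= eqxx big1 ?mul1e// => i _.
by rewrite ltn_eqF// [LHS]probability_setT.
Qed.

Let eta_itv k : {ae P, forall w, (0 <= eta k w <= 1)%R}.
Proof.
exists (eta k @^-1` ~` `[0%R, 1%R]%classic); split.
- by rewrite -[X in measurable X]setTI; apply: eta_meas => //; exact: measurableC.
- rewrite eta_law; last exact: measurableC.
  by rewrite probability_setC// nu0_01 subee.
- by move=> w /= nw; rewrite in_itv.
Qed.

(** In each component of the mixture the observation is an atom, and the diffuse law of an atom does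
    not charge 1. *)
Let v_neq1 : {ae P, forall w, forall i, v i.+1 w != 1%R}.
Proof.
apply: ae_foralln => i; pose G : set (@seqn R i.+1) := (fun y => y i) @^-1` [set 1%R].
have mG : measurable G.
  by rewrite -[X in measurable X]setTI; exact: measurable_coord.
have PG0 : P [set w | G (x^~ w)] = 0.
  rewrite (law_mixture mG) big1// => s _.
  rewrite (_ : P _ = 0) ?mule0//.
  by have := @eta_law (nth 0%N s i) [set 1%R] (measurable_set1 _); rewrite nu0_diffuse.
exists [set w | G (x^~ w)]; split => //.
- rewrite -[X in measurable X]setTI.
  by apply: (@measurable_seqn _ T R x i.+1).
- by move=> w /= /negP; rewrite negbK => /eqP.
Qed.

(* The pair [(v_j, v_{j+1})] has the same mixed moments as [(v_1, v_2)]. *)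
Let pair_rect j A : (forall i, measurable (A i)) ->
  P [set w | forall i, (i < 2)%N -> A i (v (j.+1 + i)%N w)] =
  \int[P]_w \prod_(0 <= i < 2) ssp_nu nu0 p eta w (A i).
Proof.
move=> mA; pose A' i := if i == j then A 0%N else if i == j.+1 then A 1%N else setT.
have mA' i : measurable (A' i) by rewrite /A'; case: ifP => // _; case: ifP.
transitivity (P [set w | forall i, (i < j.+2)%N -> A' i (x i w)]).
  congr (P _); apply/seteqP; split => w wA i; rewrite /A' /x.
    move=> _; case: eqVneq => [->|_]; first by have := wA 0%N isT; rewrite addn0.
    by case: eqVneq => [->|//]; have := wA 1%N isT; rewrite addn1.
  case: i => [_|[_|//]].
    by have := wA j (leqW (ltnSn j)); rewrite /A' /x eqxx addn0.
  by have := wA j.+1 (ltnSn _); rewrite /A' /x eqxx gtn_eqF// addn1.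
rewrite v_rect//; apply: eq_integral_ae.
apply: filterS (ssp_nuT_ae nu0 eta p_ae) => w nuT.
rewrite [RHS]big_ltn// [X in _ = _ * X]big_ltn// [X in _ = _ * (_ * X)]big_geq// mule1.
rewrite big_nat_recr// big_nat_recr//= /A' eqxx gtn_eqF// eqxx; congr (_ * _).
rewrite big_nat big1 ?mul1e// => i /andP[_ ij].
by rewrite ltn_eqF// ltn_eqF// ltnW.
Qed.

(** Ensures that the tied component of a pair counts with its full mass. *)
Let le_cfun_id (r : R) : (0 <= r <= 1)%R -> (r <= cfun r)%R.
Proof.
move=> /andP[r0 r1]; rewrite /cfun; case: eqVneq => [->//|rn1].
rewrite le_min r1/= ler_pdivlMr ?subr_gt0 ?lt_neqAle ?rn1//.
by rewrite ler_piMr// gerBl.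
Qed.

Lemma pair_rule j : P [set w | (v j.+2 w <= cfun (v j.+1 w))%R] =
  (pi [:: 2%N])%:E +
  (1 - (pi [:: 2%N])%:E) * \int[nu0]_y (cdf_of nu0 (cfun y))%:E.
Proof.
(* These coefficients come from the moments of [ssp_nu] alone, so they serve every consecutive pair;
   they are identified on the first two observations, where the EPPF applies directly. *)
have [q q0 qE] := ssp_mixture p_meas eta_meas p_ae p_eta_indep eta_iid 2.
have q00 : q [:: 0; 0]%N = (pi [:: 2%N])%:E.
  rewrite -(@Q_pi [:: 0; 0]%N [:: 0%N])//.
  have lawx A : (forall i, measurable (A i)) ->
      P [set w | forall i, (i < 2)%N -> A i (x i w)] =
      \sum_(s <- pats 2 | canon s)
        q s * P [set w | forall i, (i < 2)%N -> A i (eta (nth 0%N s i) w)].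
    by move=> mA; rewrite v_rect// qE.
  have := mixture_pat nu0_diffuse eta_meas eta_iid (fun i _ => mx i) q0 lawx
    (s := [:: 0; 0]%N) isT erefl measurableT.
  rewrite [X in _ * X](probability_setT P) mule1 => <-; congr (P _).
  by apply/seteqP; split => w /=; [case|].
pose X i := v (j.+1 + i)%N.
have mX i : (i < 2)%N -> measurable_fun setT (X i) by move=> _; exact: v_meas.
have lawX A : (forall i, measurable (A i)) ->
    P [set w | forall i, (i < 2)%N -> A i (X i w)] =
    \sum_(s <- pats 2 | canon s)
      q s * P [set w | forall i, (i < 2)%N -> A i (eta (nth 0%N s i) w)].
  by move=> mA; rewrite pair_rect// qE.
have patsE (F : seq nat -> \bar R) :
    \sum_(s <- pats 2 | canon s) F s = F [:: 0; 0]%N + F [:: 0; 1]%N.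
  rewrite (_ : pats 2 = [:: [:: 0; 0]; [:: 0; 1]]%N)//.
  by rewrite 2!big_cons big_nil adde0.
have PT (f : nat -> T -> R) : P [set w | forall i, (i < 2)%N -> [set: R] (f i w)] = 1.
  by rewrite -[RHS](probability_setT P); congr (P _); apply/seteqP; split.
(* Two observations have only two canonical patterns, and the total mass is one. *)
have q01 : q [:: 0; 1]%N = 1 - (pi [:: 2%N])%:E.
  have q01 := lawX (fun=> setT) (fun=> measurableT).
  rewrite PT patsE in q01; rewrite ?PT !mule1 q00 in q01.
  by rewrite [X in X - _]q01 addeAC subee// add0e.
pose H : set (@seqn R 2) := [set y : nat -> R | (y 1%N <= cfun (y 0%N))%R].
have mH : measurable H.
  have m0 : measurable_fun setT (fun y : seqn 2 => y 0%N : R) by exact: measurable_coord.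
  have mle := measurable_fun_ler (@measurable_coord R 2 1%N isT)
    (measurableT_comp (@measurable_cfun R) m0).
  by rewrite -[X in measurable X]setTI; exact: (mle measurableT (set1 true)).
transitivity (P [set w | H (X^~ w)]).
  by congr (P _); apply/seteqP; split => w; rewrite /H/= /X addn0 addn1.
rewrite (mixture_law eta_meas mX q0 lawX mH) patsE q00 q01; congr (_ + _ * _).
  rewrite -[RHS]mule1; congr (_ * _); rewrite -[RHS](probability_setT P).
  apply: eq_measure_ae => //;
    first exact: (@measurable_atoms _ _ _ _ eta_meas 2 [:: 0; 0]%N H).
  by apply: filterS (eta_itv 0) => w /le_cfun_id.
have := @new_atom 0 [:: 0%N] setT isT erefl measurableT.
rewrite (_ : mkset _ = [set w | H (fun i => eta (nth 0%N [:: 0; 1]%N i) w)]); last first.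
  by apply/seteqP; split => w; [case|].
move=> ->; rewrite (_ : mkset _ = setT)//.
have mcdf : measurable_fun setT (fun y => (cdf_of nu0 (cfun y))%:E).
  apply/measurable_EFinP.
  exact: (measurableT_comp (measurable_cdf nu0) (@measurable_cfun R)).
transitivity (\int[push P (eta_meas 0)]_y
    (cdf_of nu0 (cfun y))%:E).
  rewrite ge0_integral_pushforward//.
  by move=> y _; rewrite lee_fin cdf_ge0.
by apply: eq_measure_integral => C mC _; exact: eta_law.
Qed.

(** * From the observations to the stick-breaking weights *)

Hypothesis v_01 : forall i w, (1 <= i)%N -> (0 <= v i w <= 1)%R.

Let event_stick J : {ae P, forall w,
  (stick v J.+2 w <= stick v J.+1 w)%R = (v J.+2 w <= cfun (v J.+1 w))%R}.
Proof.
apply: filterS v_neq1 => w v1; rewrite !stickE le_stick_seq// => k.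
exact: v_01.
Qed.

Let m_event J : measurable [set w | (v J.+2 w <= cfun (v J.+1 w))%R].
Proof.
have mle := measurable_fun_ler (mx J.+1) (measurableT_comp (@measurable_cfun R) (mx J)).
by rewrite -[X in measurable X]setTI; exact: (mle measurableT (set1 true)).
Qed.

Let m_stick j : measurable_fun setT (stick v j.+1).
Proof.
apply: measurable_funM; first exact: v_meas.
apply: measurable_prod => k; rewrite mem_index_iota => /andP[k0 _].
by apply: measurable_funB => //; exact: v_meas.
Qed.

Let m_event_stick J : measurable [set w | (stick v J.+2 w <= stick v J.+1 w)%R].
Proof.
have mle := measurable_fun_ler (m_stick J.+1) (m_stick J).
by rewrite -[X in measurable X]setTI; exact: (mle measurableT (set1 true)).
Qed.

Lemma stick_pair_rule J : P [set w | (stick v J.+2 w <= stick v J.+1 w)%R] =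
  (pi [:: 2%N])%:E +
  (1 - (pi [:: 2%N])%:E) * \int[nu0]_y (cdf_of nu0 (cfun y))%:E.
Proof.
rewrite -(pair_rule J); apply: eq_measure_ae => //.
by apply: filterS (event_stick J) => w /= ->.
Qed.

Let pred_fun J : seqn J.+1 -> R :=
  fun y => predictive pi nu0 (pat J.+1 y) y (cfun (y J)).

Lemma cond_prob_v J : cond_prob_is P (sigma_rv v [set i | (1 <= i <= J.+1)%N])
  [set w | (v J.+2 w <= cfun (v J.+1 w))%R] (pred_rhs pi nu0 v J.+1).
Proof.
have predE : pred_rhs pi nu0 v J.+1 = (fun w => @pred_fun J (x^~ w)).
  by apply/funext => w; rewrite pred_rhsE.
split; first by rewrite predE; exact: (measurableT_comp (@measurable_pred J)
  (@measurable_seqn _ T R x J.+1 (fun i _ => mx i))).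
split.
  exists (pred_rhs pi nu0 v J.+1); split; last exact: aeW.
  move=> D mD; rewrite predE; apply: (@sigma_rv_preimage _ T R v J.+1 (@pred_fun J @^-1` D)).
  by rewrite -[X in measurable X]setTI; exact: measurable_pred.
by move=> B /sigma_rvP[G mG ->]; exact: predictive_rule.
Qed.

(** Every event about the weights is one about the observations, so the integral identity is
    inherited. The converse holds only up to null sets: composing with [unstick_seq] gives a version
    of the prediction that depends on the weights alone and is correct where no observation equals
    1. *)
Lemma cond_prob_stick J :
  cond_prob_is P (sigma_rv (stick v) [set i | (1 <= i <= J.+1)%N])
    [set w | (stick v J.+2 w <= stick v J.+1 w)%R] (pred_rhs pi nu0 v J.+1).
Proof.
have [mpred [_ predP]] := cond_prob_v J.
split=> //; split.
  exists (fun w => @pred_fun J (unstick_seq (fun i => stick v i.+1 w) : seqn J.+1)); split.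
    move=> D mD; apply: (@sigma_rv_preimage _ T R (stick v) J.+1
      ((fun y => @pred_fun J (unstick_seq y : seqn J.+1)) @^-1` D)).
    rewrite -[X in measurable X]setTI.
    exact: (measurableT_comp (@measurable_pred J) (@measurable_unstick_seq R J.+1)).
  apply: filterS v_neq1 => w v1; rewrite pred_rhsE /pred_fun.
  by congr (predictive _ _ (pat _ _) _ (cfun _)); do ?[apply/funext => i];
    rewrite -[RHS](stick_seqK _ v1); congr unstick_seq;
    apply/funext => k; rewrite stickE.
move=> B /sigma_rvP[G mG BE].
have sB : sigma_rv v [set i | (1 <= i <= J.+1)%N] B.
  rewrite BE (_ : mkset _ = [set w | G (stick_seq (fun i => v i.+1 w))]).
    apply: (@sigma_rv_preimage _ T R v J.+1 ((@stick_seq R) @^-1` G)).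
    by rewrite -[X in measurable X]setTI; exact: measurable_stick_seq.
  by under eq_fun do under eq_fun do rewrite stickE.
have mB : measurable B.
  rewrite BE -[X in measurable X]setTI.
  by apply: (@measurable_seqn _ T R (fun i => stick v i.+1) J.+1).
rewrite -predP//; apply: eq_measure_ae; try exact: measurableI.
by apply: filterS (event_stick J) => w /= ->.
Qed.

End predictive_rule.

Theorem theorem3 (R : realType) (d : measure_display) (T : measurableType d)
  (P : probability T R)
  (nu0 : probability R R)
  (p eta : nat -> T -> R)
  (v : nat -> T -> R)
  (pi : seq nat -> R)
  (* nu0 is a diffuse probability measure on [0,1] *)
  (Hnu0_01 : nu0 `[0, 1]%classic = 1%E)
  (Hnu0_diffuse : forall x : R, nu0 [set x] = 0%E)
  (* species sampling weights and atoms *)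
  (Hp_meas : forall k, measurable_fun setT (p k))
  (Heta_meas : forall k, measurable_fun setT (eta k))
  (Hp_ae : {ae P, forall w, (forall k, 0 <= p k w) /\
                            (\sum_(0 <= k <oo) (p k w)%:E <= 1)%E})
  (* (p_k)_k is independent of (eta_k)_k *)
  (Hindep : forall A B, sigma_rv p setT A -> sigma_rv eta setT B ->
                        P (A `&` B) = (P A * P B)%E)
  (* the eta_k are i.i.d. with law nu0 *)
  (Heta_iid : forall (n : nat) (C : nat -> set R),
      (forall k, measurable (C k)) ->
      P [set w | forall k, (k < n)%N -> C k (eta k w)] =
      (\prod_(k < n) nu0 (C k))%E)
  (* the v_i (i >= 1) are [0,1]-valued random variables *)
  (Hv_meas : forall i, (1 <= i)%N -> measurable_fun setT (v i))
  (Hv_01 : forall i w, (1 <= i)%N -> 0 <= v i w <= 1)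
  (* v_1, v_2, ... are conditionally i.i.d. given nu, with law nu *)
  (Hv_ciid : forall (n : nat) (A : nat -> set R),
      (forall i, measurable (A i)) ->
      forall B, sigma_rm (ssp_nu nu0 p eta) B ->
      P (B `&` [set w | forall i, (1 <= i <= n)%N -> A i (v i w)]) =
      (\int[P]_(w in B) \prod_(1 <= i < n.+1) ssp_nu nu0 p eta w (A i))%E)
  (* pi is the EPPF of nu: symmetric, and gives the law of the partition *)
  (Hpi : forall (n : nat) (Pt : {set {set 'I_n}}),
      finset.partition Pt [set: 'I_n] ->
      forall s : seq {set 'I_n}, perm_eq s (fintype.enum (mem Pt)) ->
      P (partition_event v Pt) = (pi (map (fun A : {set 'I_n} => #|A|) s))%:E)
  (j : nat) (Hj : (1 <= j)%N) :
  let rho := pi [:: 2%N] in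
  (* (a) *)
  P [set w | stick v (j.+1) w <= stick v j w] =
    (rho%:E + (1 - rho)%:E * \int[nu0]_(x in setT) (cdf_of nu0 (cfun x))%:E)%E
  /\
  (* (b) *)
  cond_prob_is P (sigma_rv v [set i | (1 <= i <= j)%N])
     [set w | v j.+1 w <= cfun (v j w)] (pred_rhs pi nu0 v j)
  /\
  cond_prob_is P (sigma_rv (stick v) [set i | (1 <= i <= j)%N])
     [set w | stick v (j.+1) w <= stick v j w] (pred_rhs pi nu0 v j).
Proof.
case: j Hj => // J _ rho; split.
  by rewrite EFinB; apply: (stick_pair_rule (p := p) (eta := eta)).
split; first exact: (cond_prob_v (p := p) (eta := eta)).
exact: (cond_prob_stick (p := p) (eta := eta)).
Qed.
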